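(* Let $G$ be a finitely presented group and $\Gamma$ a finite solvable group with chief series $\Gamma=\Gamma_0>\Gamma_1>\cdots>\Gamma_\nu>\Gamma_{\nu+1}=1$. Write $E_i=\Gamma_i/\Gamma_{i+1}\cong\mathbb{Z}_{q_i}^{\oplus s_i}$ ($q_i$ prime, $0\le i\le\nu$) and $B_i=\Gamma/\Gamma_i$ ($0\le i\le\nu+1$). Let $\sigma_\nu\colon B_\nu\to\mathrm{Aut}(E_\nu)$ and $\chi_\nu\colon B_\nu\times B_\nu\to E_\nu$ be the monodromy and a classifying normalized $2$-cocycle of the extension $1\to E_\nu\to B_{\nu+1}\to B_\nu\to1$, so that $B_{\nu+1}=E_\nu\times_{\sigma_\nu,\chi_\nu}B_\nu=\Gamma$. Let $\rho_0\colon G\to B_0=1$ be the trivial homomorphism. Then $$|\mathrm{Epi}(G,\Gamma)|=\sum_{\rho_{1}\in\mathrm{Epi}_{\rho_{0}}(G,B_{1})}\cdots\sum_{\rho_{\nu}\in\mathrm{Epi}_{\rho_{\nu-1}}(G,B_{\nu})}|E_{\nu}|^{\zeta_{\nu}}\left(\epsilon_{\chi_{\nu}}(\rho_{\nu})\,q_{\nu}^{\beta_{\nu}}-c_{\chi_{\nu}}\,q_{\nu}^{\kappa_{\nu}(\alpha_{\nu}-1)}\right),$$ where: - $\mathrm{Epi}_{\rho_i}(G,B_{i+1})$ is the set of epimorphisms $G\to B_{i+1}$ lifting $\rho_i\colon G\to B_i$; - $\beta_\nu=\dim_{\mathbb{Z}_{q_\nu}}H^1_{\sigma_\nu\rho_\nu}(G,E_\nu)$;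 - $\zeta_\nu=0$ if $B_\nu$ acts trivially on $E_\nu$, and $\zeta_\nu=1$ otherwise; - $\epsilon_{\chi_\nu}(\rho_\nu)=1$ if the equation $\delta^1 f=-\rho_\nu^*\chi_\nu$ has a solution $f\colon G\to E_\nu$, and $0$ otherwise; - $c_{\chi_\nu}=1$ if $[\chi_\nu]=0$ in $H^2_{\sigma_\nu}(B_\nu,E_\nu)$, and $0$ otherwise; - $\alpha_\nu$ is the number of complemented chief factors of $B_{\nu+1}$ isomorphic to $E_\nu$ as $B_{\nu+1}$-modules; - $\kappa_\nu$ is defined by $q_\nu^{\kappa_\nu}=|\mathrm{End}_{B_{\nu+1}}(E_\nu)|$.
   Context: $\mathrm{Epi}(G,\Gamma)$ denotes the set of surjective homomorphisms $G\to\Gamma$, and $\mathbb{Z}_q=\mathbb{Z}/q\mathbb{Z}$. Abelian groups are written additively. A chief series is a non-refinable series of normal subgroups of $\Gamma$; for $\Gamma$ finite solvable its factors are elementary abelian. For an extension $1\to A\xrightarrow{i}\Gamma\xrightarrow{\pi} B\to1$ with $A$ abelian and a set section $s\colon B\to\Gamma$ of $\pi$ with $s(1)=1$, the monodromy $\sigma\colon B\to\mathrm{Aut}(A)$ is defined by $i(\sigma_b(a))=s(b)i(a)s(b)^{-1}$, and the $2$-cocycle $\chi$ by $i(\chi(b,b'))=s(b)s(b')s(bb')^{-1}$; such an extension is written $\Gamma=A\times_{\sigma,\chi}B$. For $\rho\colon G\to B$, $A$ is a $G$-module via $\sigma\rho$, and $H^1_{\sigma\rho}(G,A)$ is group cohomology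 with these coefficients. For $f\colon G\to A$, $(\delta^1 f)(g,h)=\sigma_{\rho(g)}(f(h))-f(gh)+f(g)$, and $(\rho^*\chi)(g,h)=\chi(\rho(g),\rho(h))$. Chief factors are the quotients $H/K$ of consecutive terms of a chief series, counted with multiplicity and viewed as modules under conjugation. A chief factor $H/K$ of a group $\Gamma$ is complemented if it has a complement in $\Gamma/K$. $\mathrm{End}_{B_{\nu+1}}(E_\nu)$ is the ring of $B_{\nu+1}$-module endomorphisms of $E_\nu$. *)

(* Defs.v *)
From HB Require Import structures.
From mathcomp Require Import all_boot all_order all_algebra all_fingroup.
From mathcomp Require Import all_solvable.
From mathcomp Require Import ring_quotient.
From mathcomp Require Import finmap.
From mathcomp Require Import boolp classical_sets functions cardinality fsbigop.

Set Implicit Arguments.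
Unset Strict Implicit.
Unset Printing Implicit Defensive.

Import GRing.Theory.

Local Open Scope ring_scope.
Local Open Scope classical_set_scope.

(* [(i, false)] is the letter x_i and [(i, true)] its inverse. *)
Definition word (n : nat) := seq ('I_n * bool).

Definition eval_word (G : groupType) (n : nat) (x : 'I_n -> G) (w : word n) : G :=
  foldr (fun l g => ((if l.2 then (x l.1)^-1 else x l.1) * g)%g) 1%g w.

(* Equality in the group with n generators and relators R. *)
Inductive presented_eq (n : nat) (R : seq (word n)) : word n -> word n -> Prop :=
| PresRefl w : presented_eq R w w
| PresSym w w' : presented_eq R w w' -> presented_eq R w' w
| PresTrans w w' w'' :
    presented_eq R w w' -> presented_eq R w' w'' -> presented_eq R w w''
| PresFree u v i b :
    presented_eq R (u ++ (i, b) :: (i, ~~ b) :: v) (u ++ v)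
| PresRel u v r : r \in R -> presented_eq R (u ++ r ++ v) (u ++ v).

Definition finitely_presented (G : groupType) : Prop :=
  exists (n : nat) (x : 'I_n -> G) (R : seq (word n)),
    (forall g : G, exists w : word n, eval_word x w = g) /\
    (forall w w' : word n,
       eval_word x w = eval_word x w' <-> presented_eq R w w').

Definition Epi (G H : groupType) : set (G -> H) :=
  [set f | {morph f : x y / (x * y)%g} /\ range f = setT].
Arguments Epi : clear implicits.

(* For K <= H normal in gT, the canonical projection gT / K -> gT / H. *)
Definition qproj (gT : finGroupType) (K H : {group gT}) (x : coset_of K) :
  coset_of H := coset H (repr x).

Definition EpiLift (G : groupType) (gT : finGroupType) (H K : {group gT})
    (rho : G -> coset_of H) : set (G -> coset_of K) :=
  [set f | Epi G (coset_of K) f /\ forall g, qproj H (f g) = rho g].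
Arguments EpiLift {G gT H} K rho.

(* With B_i = gT / Gam i and F depending on rho_n : G -> B_n, this is
   \sum_(rho_1 in Epi_{rho_0}(G, B_1)) ...
     \sum_(rho_n in Epi_{rho_(n-1)}(G, B_n)) F rho_n
   where rho_0 is trivial.  The index sets are finite as soon as G is finitely
   generated, so the sums over classical sets carry no default values. *)
Fixpoint iterated_sum (G : groupType) (gT : finGroupType)
    (Gam : nat -> {group gT}) (n : nat) : ((G -> coset_of (Gam n)) -> rat) -> rat :=
  match n with
  | 0 => fun F => F (fun=> 1%g)
  | m.+1 => fun F => iterated_sum (fun rho : G -> coset_of (Gam m) =>
      \sum_(rho' \in EpiLift (Gam m.+1) rho) F rho')
  end.

(* Cohomology of G with coefficients in F^n, on which g acts by the matrix
   [act g] (for F = 'F_p, Aut(F^n) is the group of invertible matrices). *)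
Section Cohomology.
Variables (F : fieldType) (n : nat) (G : groupType) (act : G -> 'M[F]_n).

Definition delta1 (f : G -> 'cV[F]_n) (g h : G) : 'cV[F]_n :=
  act g *m f h - f (g * h)%g + f g.

Definition Z1 : {pred (G -> 'cV[F]_n)} :=
  fun f => `[< forall g h, delta1 f g h = 0 >].

Lemma Z1_submod_closed : submod_closed Z1.
Proof.
split=> [|a u v /asboolP Hu /asboolP Hv]; apply/asboolP => g h; rewrite /delta1.
  by rewrite mulmx0 subr0 addr0.
have -> : act g *m (a *: u + v) h - (a *: u + v) (g * h)%g + (a *: u + v) g =
    a *: delta1 u g h + delta1 v g h.
  rewrite /delta1 mulmxDr -scalemxAr !scalerDr scalerN opprD.
  by rewrite [X in X + _ = _]addrACA [LHS]addrACA.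
by rewrite Hu Hv scaler0 addr0.
Qed.

HB.instance Definition _ :=
  GRing.isSubmodClosed.Build F (G -> 'cV[F]_n) Z1 Z1_submod_closed.

Record cocycle := Cocycle { cocycle_val :> G -> 'cV[F]_n; _ : cocycle_val \in Z1 }.
HB.instance Definition _ := [isSub for cocycle_val].
HB.instance Definition _ := [Choice of cocycle by <:].
HB.instance Definition _ := [SubChoice_isSubLmodule of cocycle by <:].

Definition B1 : {pred cocycle} :=
  fun f => `[< exists v : 'cV[F]_n, forall g, f g = act g *m v - v >].

Lemma B1_submod_closed : submod_closed B1.
Proof.
split=> [|a u w /asboolP[v Hv] /asboolP[v' Hv']]; apply/asboolP.
  by exists 0 => g; rewrite mulmx0 subr0.
exists (a *: v + v') => g.
rewrite mulmxDr -scalemxAr opprD addrACA -scalerBr -Hv -Hv'.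
by [].
Qed.

HB.instance Definition _ :=
  GRing.isSubmodClosed.Build F cocycle B1 B1_submod_closed.

Definition H1 : Type := Quotient.quot B1.
HB.instance Definition _ := GRing.Zmodule.on H1.

Definition pi_H1 (f : cocycle) : H1 := (\pi_(Quotient.quot B1) f)%qT.

Definition H1_scale (a : F) (x : H1) : H1 := pi_H1 (a *: (generic_quotient.repr x : cocycle)).

Let pi_H1_scale a f : H1_scale a (pi_H1 f) = pi_H1 (a *: f).
Proof.
apply/eqP; rewrite /H1_scale /pi_H1 -Quotient.idealrBE -scalerBr rpredZ //.
by rewrite Quotient.idealrBE reprK.
Qed.

Let pi_H1D f g : pi_H1 f + pi_H1 g = pi_H1 (f + g).
Proof. by rewrite /pi_H1 [RHS]raddfD. Qed.

Let pi_H1_ind (P : H1 -> Prop) : (forall f, P (pi_H1 f)) -> forall x, P x.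
Proof. by move=> Pf; elim/quotW. Qed.

Let H1_scaleA a b x : H1_scale a (H1_scale b x) = H1_scale (a * b) x.
Proof. by elim/pi_H1_ind: x => f; rewrite !pi_H1_scale scalerA. Qed.

Let H1_scale1 : left_id 1 H1_scale.
Proof. by elim/pi_H1_ind=> f; rewrite pi_H1_scale scale1r. Qed.

Let H1_scaleDr : right_distributive H1_scale +%R.
Proof.
move=> a; elim/pi_H1_ind=> f; elim/pi_H1_ind=> g.
by rewrite !(pi_H1_scale, pi_H1D) scalerDr.
Qed.

Let H1_scaleDl x : {morph H1_scale^~ x : a b / a + b}.
Proof. by elim/pi_H1_ind: x => f a b; rewrite !(pi_H1_scale, pi_H1D) scalerDl. Qed.

HB.instance Definition _ := GRing.Zmodule_isLmodule.Build F H1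
  H1_scaleA H1_scale1 H1_scaleDr H1_scaleDl.

End Cohomology.

(* The dimension of L over F, and 0 if L is not finite-dimensional. *)
Definition dimension (F : fieldType) (L : lmodType F) : nat :=
  xget 0%N [set n | exists f : L -> 'rV[F]_n, linear f /\ bijective f].

Definition chief_series (gT : finGroupType) (nu : nat) (Gam : nat -> {group gT}) :
    Prop :=
  [/\ Gam 0 = [set: gT]%G, Gam nu.+1 = 1%G &
    forall i, (i <= nu)%N -> chief_factor [set: gT]%G (Gam i.+1) (Gam i)].

Section TopExtension.
Variables (gT : finGroupType) (Gam : nat -> {group gT}) (nu : nat).

Local Notation B i := (coset_of (Gam i)).
Local Notation E i := (Gam i / Gam i.+1)%g.

(* B (nu.+1) acts on E i by conjugation through its projection onto
   B (i.+1). *)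
Definition module_isomorphic_top (i : nat) : Prop :=
  exists f : {morphism E i >-> B nu.+1}, isom (E i) (E nu) f /\
    forall (x : B nu.+1) (a : B i.+1), a \in E i ->
      f (qproj (Gam i.+1) x * a * (qproj (Gam i.+1) x)^-1)%g =
      (x * f a * x^-1)%g.

Definition complemented_factor (i : nat) : bool :=
  [splits [set: gT]%G / Gam i.+1, over E i]%g.

Definition alpha : nat :=
  #|[pred i : 'I_nu.+1 |
      complemented_factor i && `[< module_isomorphic_top i >]]|.

Variables (p r : nat).
Local Notation V := 'cV['F_p]_r.
Variables (sigma : B nu -> 'M['F_p]_r) (chi : B nu -> B nu -> V).

Definition zeta : nat := ~~ `[< forall b (v : V), sigma b *m v = v >].

Definition epsilon (G : groupType) (rho : G -> B nu) : bool :=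
  `[< exists f : G -> V, forall g h,
        delta1 (sigma \o rho) f g h = - chi (rho g) (rho h) >].

Definition c_chi : bool :=
  `[< exists t : B nu -> V, forall b b', delta1 sigma t b b' = chi b b' >].

(* B (nu.+1) acts on V through its projection onto B nu. *)
Definition endomorphisms : {pred {ffun V -> V}} :=
  [pred f : {ffun V -> V} |
    [forall u, forall v, f (u + v) == f u + f v] &&
    [forall x : B nu.+1, forall v,
      f (sigma (qproj (Gam nu) x) *m v) == sigma (qproj (Gam nu) x) *m f v]].

End TopExtension.

(* Main.v *)
Require Import Defs.
From HB Require Import structures.
From mathcomp Require Import all_boot all_order all_algebra all_fingroup.
From mathcomp Require Import all_solvable.
From mathcomp Require Import boolp.

Set Implicit Arguments.
Unset Strict Implicit.
Unset Printing Implicit Defensive.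

Import GRing.Theory.

Local Open Scope ring_scope.

(** Every epimorphism from G onto the last quotient projects to a unique chain of
    epimorphisms onto the smaller ones, so the iterated sum counts epimorphisms as
    soon as the summand counts the surjective lifts of rho : G -> B nu to B nu.+1
    ([iterated_sum_Epi]). Fix such a rho and write E for the last chief factor.

    Lifts. If rho lifts at all, which is the vanishing of the obstruction, its lifts
    form a torsor under the cocycles of G with values in E ([lifts_torsor]). There
    are |B^1| |H^1| cocycles, and |B^1| is 1 or |E| because E is irreducible
    ([card_Z1], [card_B1]). A lift that is not onto meets E trivially, by
    irreducibility again, and hence is rho followed by a splitting of the extension
    ([nonsurjective_lifts]). So the surjective lifts are all lifts minus the
    splittings, and there are splittings exactly if the class of chi is zero.

    Splittings. These form a torsor under the cocycles of B nu with values in E,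
    which are the cocycles of the whole finite group that vanish on Gam nu. They are
    counted by adding the chief factors one at a time, that is by comparing the
    cocycles vanishing on Gam i with those vanishing on Gam i.+1.
    - If Gam i acts nontrivially on E, no nonzero cocycle vanishes on it
      ([cocycles_vanishing_nontrivial]).
    - If Gam i.+1 acts trivially and Gam i does not, the chief factor is not a
      p-group, for a p-group has nonzero fixed vectors in characteristic p
      ([pgroup_acts_trivially]); being of prime power order it has order prime to p,
      and an averaging argument leaves just the |E| coboundaries
      ([card_cocycles_vanishing_coprime]). This step occurs exactly if the action on
      E is nontrivial.
    - If Gam i acts trivially, a cocycle that vanishes on Gam i.+1 but not on Gam i
      induces an isomorphism from the chief factor to E, and its zeros form a
      complement of the factor. If there is one, all others are obtained from it up
      to cocycles vanishing on Gam i by an endomorphism of E, so that the number of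
      cocycles is multiplied by |End E| ([card_cocycles_vanishing_split]); this
      happens exactly for the complemented factors isomorphic to E
      ([cocycle_of_split_top_factor], [split_top_factor_of_cocycle]).
    If the extension splits, E itself is such a factor, hence the exponent
    alpha - 1. *)

(** * Irreducible modules and cocycles vanishing on a normal subgroup *)

(** Vectors are columns over a finite field, and submodules are finite sets closed
    under subtraction and the action: over a prime field these are exactly the
    invariant subspaces. *)
Definition irreducible_action (G : Type) (F : finFieldType) (r : nat)
    (act : G -> 'M[F]_r) : Prop :=
  forall W : {set 'cV[F]_r}, 0 \in W -> {in W &, forall u v, u - v \in W} ->
    (forall g, {in W, forall v, act g *m v \in W}) ->
  W = [set 0] \/ W = [set: 'cV[F]_r].

Lemma fixed_vectors_irreducible (G : Type) (F : finFieldType) (r : nat)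
    (act : G -> 'M[F]_r) :
    irreducible_action act ->
  (forall g (v : 'cV[F]_r), act g *m v = v) \/
  (forall v : 'cV[F]_r, (forall g, act g *m v = v) -> v = 0).
Proof.
move=> irr; pose W := finset (fun v : 'cV[F]_r => `[< forall g, act g *m v = v >]).
have inW v : reflect (forall g, act g *m v = v) (v \in W).
  by rewrite inE; apply: asboolP.
have [|||W0|WT] := irr W.
- by apply/inW => g; rewrite mulmx0.
- by move=> u v /inW fu /inW fv; apply/inW => g; rewrite mulmxBr fu fv.
- by move=> g v fv; rewrite (inW v fv g).
- by right=> v /inW; rewrite W0 inE => /eqP.
- by left=> g v; apply: (inW v); rewrite WT inE.
Qed.

Section FiniteCocycles.
Variables (gT : finGroupType) (F : finFieldType) (r : nat).
Variable act : gT -> 'M[F]_r.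
Local Notation V := 'cV[F]_r.
Local Notation G := [set: gT]%G.
Hypotheses (actM : forall x y, act (x * y)%g = act x *m act y)
  (act1 : act 1%g = 1%:M) (irr : irreducible_action act).

Definition acts_trivially (N : {set gT}) : Prop :=
  forall x (v : V), x \in N -> act x *m v = v.

(** Finite functions make the cocycles of a finite group a finite set. For N
    normal and acting trivially, these are the cocycles of the quotient by N; the
    advantage of keeping the whole group as domain is that the sets for the terms
    of a chief series are nested, whether or not the terms act trivially. *)
Definition cocycles_vanishing (N : {set gT}) : {set {ffun gT -> V}} :=
  finset (fun f : {ffun gT -> V} =>
    [forall x, forall y, f (x * y)%g == f x + act x *m f y] &&
    [forall x in N, f x == 0]).

Lemma cocycles_vanishingP (N : {set gT}) (f : {ffun gT -> V}) :
  reflect ((forall x y, f (x * y)%g = f x + act x *m f y) /\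
           (forall x, x \in N -> f x = 0))
          (f \in cocycles_vanishing N).
Proof.
rewrite inE; apply: (iffP andP) => [[/forallP fM /forall_inP f0]|[fM f0]]; split.
- by move=> x y; apply/eqP; move/forallP: (fM x).
- by move=> x /f0 /eqP.
- by apply/forallP => x; apply/forallP => y; rewrite fM.
- by apply/forall_inP => x /f0 ->.
Qed.

Lemma cocycle_at1 (f : gT -> V) :
  (forall x y, f (x * y)%g = f x + act x *m f y) -> f 1%g = 0.
Proof.
move=> fM; have := fM 1%g 1%g; rewrite mulg1 act1 mul1mx => /eqP.
by rewrite -subr_eq0 opprD addrA subrr sub0r oppr_eq0 => /eqP.
Qed.

Lemma zero_cocycle_vanishing (N : {set gT}) : 0 \in cocycles_vanishing N.
Proof.
by apply/cocycles_vanishingP; split=> [x y|x _]; rewrite !ffunE ?mulmx0 ?addr0.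
Qed.

Lemma cocycles_vanishingB (N : {set gT}) (f g : {ffun gT -> V}) :
    f \in cocycles_vanishing N -> g \in cocycles_vanishing N ->
  f - g \in cocycles_vanishing N.
Proof.
move=> /cocycles_vanishingP[fM f0] /cocycles_vanishingP[gM g0].
apply/cocycles_vanishingP; split=> [x y|x Nx]; rewrite !ffunE.
  by rewrite fM gM mulmxBr opprD addrACA.
by rewrite f0 // g0 // subrr.
Qed.

Lemma cocycles_vanishingS (M N : {set gT}) :
  M \subset N -> {subset cocycles_vanishing N <= cocycles_vanishing M}.
Proof.
move=> sMN f /cocycles_vanishingP[fM f0]; apply/cocycles_vanishingP.
by split=> // x /(subsetP sMN); apply: f0.
Qed.

Lemma fixed_vectors_normal (N : {group gT}) : (N <| G)%g ->
  acts_trivially N \/ (forall v : V, (forall x, x \in N -> act x *m v = v) -> v = 0).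
Proof.
move=> nN; pose W := finset (fun v : V => [forall x in N, act x *m v == v]).
have inW v : reflect (forall x, x \in N -> act x *m v = v) (v \in W).
  rewrite inE; apply: (iffP forall_inP) => fv x Nx; first exact/eqP/fv.
  by rewrite fv.
have [|||W0|WT] := irr (W := W).
- by apply/inW => x _; rewrite mulmx0.
- by move=> u v /inW fu /inW fv; apply/inW => x Nx; rewrite mulmxBr fu // fv.
- move=> g v /inW fv; apply/inW => x Nx.
  rewrite mulmxA -actM [(x * g)%g]conjgC actM -mulmxA fv //.
  by rewrite memJ_norm // (subsetP (normal_norm nN)) // inE.
- by right=> v /inW; rewrite W0 inE => /eqP.
- by left=> x v Nx; apply: (inW v) => //; rewrite WT inE.
Qed.

(** Since f (n x) = f (x n^x), such a cocycle takes its values in the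
    submodule of N-fixed vectors, which irreducibility makes zero. *)
Lemma cocycles_vanishing_nontrivial (N : {group gT}) :
  (N <| G)%g -> ~ acts_trivially N -> cocycles_vanishing N = [set (0 : {ffun gT -> V})].
Proof.
move=> nN ntN; have [//|fix0] := fixed_vectors_normal nN.
apply/setP => f; apply/idP/set1P => [|->]; last exact: zero_cocycle_vanishing.
case/cocycles_vanishingP => fM f0; apply/ffunP => x; rewrite ffunE.
apply: fix0 => n Nn; have := fM n x; rewrite (f0 n Nn) add0r => <-.
rewrite conjgC fM (f0 (n ^ x)%g) ?mulmx0 ?addr0 //.
by rewrite memJ_norm // (subsetP (normal_norm nN)) // inE.
Qed.

Lemma cocycle_mulr_vanishing (N : {set gT}) f x y :
  f \in cocycles_vanishing N -> y \in N -> f (x * y)%g = f x.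
Proof. by case/cocycles_vanishingP => fM f0 Ny; rewrite fM (f0 y) // mulmx0 addr0. Qed.

Lemma cocycle_constant_coset (N : {group gT}) f x :
  (N <| G)%g -> f \in cocycles_vanishing N -> f (repr (coset N x) : gT) = f x.
Proof.
move=> nN fN; have Nx : x \in 'N(N)%g by rewrite (subsetP (normal_norm nN)) // inE.
have : repr (coset N x) \in (N :* x)%g by rewrite -val_coset // mem_repr_coset.
case/rcosetP => n Nn ->; rewrite conjgC (cocycle_mulr_vanishing _ fN) //.
by rewrite memJ_norm.
Qed.

Lemma act_trivial_coset (N : {group gT}) x :
  (N <| G)%g -> acts_trivially N -> forall v : V, act (repr (coset N x)) *m v = act x *m v.
Proof.
move=> nN tN v; have Nx : x \in 'N(N)%g by rewrite (subsetP (normal_norm nN)) // inE.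
have : repr (coset N x) \in (N :* x)%g by rewrite -val_coset // mem_repr_coset.
by case/rcosetP => n Nn ->; rewrite actM -mulmxA tN.
Qed.

Section Quotient.
Variables M N : {group gT}.
Hypotheses (nM : (M <| G)%g) (nN : (N <| G)%g) (sMN : M \subset N)
  (tM : acts_trivially M).

Let normM x : x \in 'N(M)%g.
Proof. by rewrite (subsetP (normal_norm nM)) // inE. Qed.

(* The inverse turns the left action by matrices into a right action. *)
Let to (v : V) (c : coset_of M) : V := act (repr c^-1%g) *m v.

Lemma quotient_action_subproof : is_action [set: coset_of M] to.
Proof.
have toE v x : to v (coset M x) = act x^-1%g *m v.
  by rewrite /to -morphV //= act_trivial_coset.
split=> [c u v|v c d _ _].
  have [x Nx ->] := cosetP c; rewrite !toE => /(congr1 (mulmx (act x))).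
  by rewrite !mulmxA -!actM mulgV act1 !mul1mx.
have [x Nx ->] := cosetP c; have [y Ny ->] := cosetP d.
by rewrite -morphM //= !toE invMg actM mulmxA.
Qed.

Let toA := Action quotient_action_subproof.

(** In characteristic p a p-group fixes a nonzero vector, and the vectors
    fixed by a normal subgroup form a submodule. *)
Lemma pgroup_acts_trivially (p : nat) :
  p \in [pchar F] -> (p.-group (N / M))%g -> acts_trivially N.
Proof.
move=> charFp pNM; have [//|fix0] := fixed_vectors_normal nN.
suff V0 (v : V) : v = 0 by move=> x v _; rewrite (V0 v) mulmx0.
have p_pr := pcharf_prime charFp.
have: [acts (N / M), on [set: V] | toA]%g.
  by apply/subsetP => c cN; rewrite !inE; apply/subsetP => u _; rewrite !inE.
move/(pgroup_fix_mod pNM).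
have -> : 'Fix_([set: V] | toA)(N / M)%g = [set 0].
  apply/setP=> u; rewrite !inE /=; apply/subsetP/eqP => [fu|->].
    apply: fix0 => x Nx.
    have := fu (coset M x^-1%g) (mem_quotient _ _); rewrite groupV => /(_ Nx).
    rewrite !inE /= => /eqP; rewrite /to.
    by rewrite -morphV ?normM //= invgK act_trivial_coset.
  by move=> c _; rewrite !inE /= /to mulmx0.
rewrite cards1 cardsT (modn_small (prime_gt1 p_pr)) => V1.
case: (eqVneq v 0) => // v0.
suff: (p %| #|V|)%N by rewrite /dvdn V1.
have pv : v *+ p = 0 by rewrite -scaler_nat (pcharf0 charFp) scale0r.
rewrite -cardsT -(@nt_prime_order V p v p_pr) //.
by apply: order_dvdG; rewrite inE.
Qed.

(** N being nontrivial on V, no nonzero cocycle vanishes on N. Averaging over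
    the coset space N / M, whose order is invertible, makes every cocycle agree on
    N with a coboundary, hence equal it. *)
Lemma card_cocycles_vanishing_coprime :
    #|(N / M)%g|%:R != 0 :> F -> ~ acts_trivially N ->
  #|cocycles_vanishing M| = #|{: V}|.
Proof.
move=> m0 ntN.
pose d (w : V) : {ffun gT -> V} := [ffun x => act x *m w - w].
have dM w : d w \in cocycles_vanishing M.
  apply/cocycles_vanishingP; split=> [x y|x Mx]; rewrite !ffunE; last first.
    by rewrite tM // subrr.
  by rewrite actM mulmxBr mulmxA [RHS]addrC addrA subrK.
have fix0 (v : V) : (forall x, x \in N -> act x *m v = v) -> v = 0.
  by move: v; have [/ntN|] := fixed_vectors_normal nN.
have dinj : injective d.
  move=> u w /ffunP duw; apply/eqP; rewrite -subr_eq0; apply/eqP/fix0 => x _.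
  have := duw x; rewrite !ffunE mulmxBr -{2}(subrK u (act x *m u)) => ->.
  by rewrite [LHS]addrC -addrA addKr addrC.
rewrite -(card_codom dinj); apply: eq_card => f; apply/idP/idP; last first.
  by case/codomP => w ->.
move=> fM; have [fD _] := cocycles_vanishingP _ _ fM.
pose m : F := #|(N / M)%g|%:R.
pose S := \sum_(c in (N / M)%g) f (repr c).
have avg x : x \in N -> S = m *: f x + act x *m S.
  move=> Nx; rewrite {1}/S (reindex_inj (h := fun c : coset_of M => (coset M x * c)%g) (@mulgI _ (coset M x))).
  rewrite (eq_bigl (mem (N / M)%g)) => [|c]; last by rewrite groupMl ?mem_quotient.
  rewrite (eq_bigr (fun c : coset_of M => f x + act x *m f (repr c))) => [|c _]; last first.
    have [y Ny ->] := cosetP c.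

    have -> : (coset M x * coset M y)%g = coset M (x * y)%g by rewrite morphM ?normM.
    by rewrite !cocycle_constant_coset.
  by rewrite big_split /= sumr_const -scaler_nat mulmx_sumr.
apply/codomP; exists (- (m^-1 *: S)).
suff: f - d (- (m^-1 *: S)) \in cocycles_vanishing N.
  rewrite cocycles_vanishing_nontrivial // => /set1P /eqP.
  by rewrite subr_eq0 => /eqP.
have /cocycles_vanishingP[gM _] := cocycles_vanishingB fM (dM (- (m^-1 *: S))).
apply/cocycles_vanishingP; split=> // x Nx; rewrite !ffunE.
have fx : f x = m^-1 *: (S - act x *m S).
  by rewrite {1}(avg x Nx) addrK scalerA mulVf // scale1r.
by rewrite fx mulmxN -scalemxAr opprK scalerBr [X in _ - X]addrC subrr.
Qed.

Definition equivariant_endomorphisms : {set {ffun V -> V}} :=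
  finset (fun e : {ffun V -> V} =>
    [forall u, forall v, e (u + v) == e u + e v] &&
    [forall x, forall v, e (act x *m v) == act x *m e v]).

Lemma equivariant_endomorphismsP (e : {ffun V -> V}) :
  reflect ({morph e : u v / u + v} /\ forall x v, e (act x *m v) = act x *m e v)
          (e \in equivariant_endomorphisms).
Proof.
rewrite inE; apply: (iffP andP) => [[/forallP eD /forallP eA]|[eD eA]]; split.
- by move=> u v; apply/eqP; move/forallP: (eD u).
- by move=> x v; apply/eqP; move/forallP: (eA x).
- by apply/forallP => u; apply/forallP => v; rewrite eD.
- by apply/forallP => x; apply/forallP => v; rewrite eA.
Qed.

Section ActsTrivially.
Hypotheses (tN : acts_trivially N) (chiefMN : chief_factor G M N).

(** On a normal subgroup acting trivially, a cocycle restricts to an equivariant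
    homomorphism for conjugation. *)
Lemma cocycle_conj f x n :
  f \in cocycles_vanishing M -> n \in N -> f (x * n * x^-1)%g = act x *m f n.
Proof.
case/cocycles_vanishingP => fM _ Nn.
have fx : f x + act x *m f x^-1%g = 0.
  by rewrite -fM mulgV (cocycle_at1 fM).
rewrite !fM actM -mulmxA addrAC.
by rewrite (tN _ Nn) fx add0r.
Qed.

Section Nonzero.
Variable f : {ffun gT -> V}.
Hypotheses (fM : f \in cocycles_vanishing M) (f_neq0 : exists2 n, n \in N & f n != 0).

(** The image of N is a nonzero submodule. *)
Lemma cocycle_onto (v : V) : exists2 n, n \in N & f n = v.
Proof.
have [fD f0] := cocycles_vanishingP _ _ fM.
have fDN x y : x \in N -> f (x * y)%g = f x + f y by move=> Nx; rewrite fD tN.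
have fV x : x \in N -> f x^-1%g = - f x.
  by move=> Nx; apply/eqP; rewrite -addr_eq0 addrC -fDN // mulgV (cocycle_at1 fD).
have [|u w /imsetP[x Nx ->] /imsetP[y Ny ->]|x u /imsetP[n Nn ->]|W0|WT] :=
  irr (W := [set f n | n in N]).
- by apply/imsetP; exists 1%g; rewrite ?group1 ?(cocycle_at1 fD).
- by apply/imsetP; exists (x * y^-1)%g; rewrite ?groupM ?groupV // fDN // fV.
- apply/imsetP; exists (x * n * x^-1)%g; last by rewrite cocycle_conj.
  have := memJ_norm n (subsetP (normal_norm nN) (x^-1)%g (in_setT _)).
  by rewrite conjgE invgK mulgA Nn.
- have [n Nn] := f_neq0; have : f n \in [set f n | n in N] by apply: imset_f.
  by rewrite W0 inE => ->.
have : v \in [set f n | n in N] by rewrite WT inE.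
by case/imsetP => n Nn ->; exists n.
Qed.

(** The zeros of f in N form a proper subgroup of N, normal in the whole group and
    containing M, and N / M is a chief factor. *)
Lemma cocycle_kernel n : n \in N -> f n = 0 -> n \in M.
Proof.
move=> Nn fn0; have [fD f0] := cocycles_vanishingP _ _ fM.
have fDN x y : x \in N -> f (x * y)%g = f x + f y by move=> Nx; rewrite fD tN.
have K_group : group_set [set x in N | f x == 0].
  apply/group_setP; split=> [|x y]; first by rewrite inE group1 (cocycle_at1 fD) eqxx.
  rewrite !inE => /andP[Nx /eqP fx] /andP[Ny /eqP fy].
  by rewrite groupM // fDN // fx fy addr0 eqxx.
pose K := Group K_group; suff <- : K :=: M by rewrite inE Nn fn0 eqxx.
have [maxM _] := andP chiefMN; have [_ maxM'] := maxgroupP maxM.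
apply: maxM'; last first.
  by apply/subsetP => x Mx; rewrite inE (subsetP sMN) // f0 // eqxx.
rewrite /proper; apply/andP; split; last first.
  apply/subsetP => x _; rewrite inE; apply/subsetP => _ /imsetP[k + ->].
  rewrite !inE => /andP[Nk /eqP fk].
  rewrite memJ_norm ?Nk /=; last by rewrite (subsetP (normal_norm nN)) // inE.
  by rewrite conjgE mulgA -{2}[x]invgK cocycle_conj // fk mulmx0.
apply/andP; split; first by apply/subsetP => x; rewrite inE => /andP[].
have [x Nx fx] := f_neq0; apply/subsetPn; exists x => //.
by rewrite inE Nx.
Qed.

(** By Schur, f identifies N / M with V, so on N any cocycle vanishing on M is
    e o f for a unique endomorphism e. *)
Lemma card_cocycles_vanishing_split :
  #|cocycles_vanishing M| =
  (#|cocycles_vanishing N| * #|equivariant_endomorphisms|)%N.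
Proof.
have [fD f0] := cocycles_vanishingP _ _ fM.
have fDN x y : x \in N -> f (x * y)%g = f x + f y by move=> Nx; rewrite fD tN.
pose h (ze : {ffun gT -> V} * {ffun V -> V}) : {ffun gT -> V} :=
  [ffun x => ze.1 x + ze.2 (f x)].
have e0 e : e \in equivariant_endomorphisms -> e 0 = 0.
  case/equivariant_endomorphismsP => eD _.
  by apply: (addrI (e 0)); rewrite -eD !addr0.
have hM z e : z \in cocycles_vanishing N -> e \in equivariant_endomorphisms ->
    h (z, e) \in cocycles_vanishing M.
  move=> zN eE; have [eD eA] := equivariant_endomorphismsP _ eE.
  have [zD z0] := cocycles_vanishingP _ _ zN.
  apply/cocycles_vanishingP; split=> [x y|x Mx]; rewrite !ffunE /=.
    by rewrite zD fD eD eA mulmxDr addrACA.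
  by rewrite z0 ?(subsetP sMN) // f0 // e0 // addr0.
rewrite -cardsX -(card_in_imset (f := h)); last first.
  move=> [z e] [z' e'] /setXP[zN eE] /setXP[zN' eE'] /ffunP hh.
  have [zD z0] := cocycles_vanishingP _ _ zN.
  have [zD' z0'] := cocycles_vanishingP _ _ zN'.
  have ee : e = e'.
    apply/ffunP => v; have [n Nn <-] := cocycle_onto v.
    by have := hh n; rewrite !ffunE /= z0 // z0' // !add0r.
  rewrite ee; congr (_, _); apply/ffunP => x.
  by have := hh x; rewrite !ffunE /= ee => /addIr.
apply: eq_card => g; apply/idP/imsetP => [gM|[[z e] /setXP[zN eE] ->]]; last exact: hM.
have [gD g0] := cocycles_vanishingP _ _ gM.
(* e sends f n to g n; two choices of n differ by a zero of f in N, hence by an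
   element of M, where g vanishes. *)
pose e : {ffun V -> V} := [ffun v => g (odflt 1%g [pick n in N | f n == v])].
have ef n : n \in N -> e (f n) = g n.
  move=> Nn; rewrite ffunE; case: pickP => [k /andP[Nk /eqP fkn]|/(_ n)]; last first.
    by rewrite Nn eqxx.
  rewrite /= -[n](mulKVg k) (cocycle_mulr_vanishing _ gM) //.
  apply: cocycle_kernel; first by rewrite groupM ?groupV.
  apply: (addrI (f k)); rewrite -fDN // mulKVg addr0; exact/esym.
clearbody e; have eE : e \in equivariant_endomorphisms.
  apply/equivariant_endomorphismsP; split=> [u v|x u].
    have [m Nm <-] := cocycle_onto u; have [n Nn <-] := cocycle_onto v.
    by rewrite -fDN // !ef ?groupM // gD tN.
  have [m Nm <-] := cocycle_onto u; rewrite -cocycle_conj // !ef ?cocycle_conj //.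
  have := memJ_norm m (subsetP (normal_norm nN) (x^-1)%g (in_setT _)).
  by rewrite conjgE invgK mulgA Nm.
have [eD eA] := equivariant_endomorphismsP _ eE.
exists ([ffun x => g x - e (f x)], e); last first.
  by apply/ffunP => x; rewrite !ffunE /= subrK.
rewrite inE /= eE andbT; apply/cocycles_vanishingP.
split=> [x y|x Nx]; rewrite !ffunE; last by rewrite ef // subrr.
by rewrite gD fD eD eA mulmxBr opprD addrACA.
Qed.

End Nonzero.
End ActsTrivially.
End Quotient.
End FiniteCocycles.

From mathcomp Require Import finmap.
From mathcomp Require Import classical_sets functions cardinality fsbigop.

Local Open Scope classical_set_scope.

(** * Counting *)

Local Notation "`#| A |" := #|` fset_set A| (at level 0, A at level 99).

Lemma finite_set_inj_fin (T : Type) (X : finType) (A : set T) (h : T -> X) :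
  set_inj A h -> finite_set A.
Proof.
move=> hinj; rewrite -(eq_finite_set (inj_card_eq hinj)); exact: finite_finset.
Qed.

Lemma card_set_bij (T U : choiceType) (A : set T) (B : set U) (h : T -> U) :
  finite_set A -> set_bij A B h -> `#|B| = `#|A|.
Proof.
move=> finA [hAB hinj hsurj].
have -> : B = h @` A by rewrite eqEsubset; split=> // _ [x Ax <-]; apply: hAB.
rewrite fset_set_image // card_in_imfset // => x y.
by rewrite !in_fset_set //; apply: hinj.
Qed.

Lemma card_fset_set_fin (X : finType) (P : {pred X}) : `#|[set` P]| = #|P|.
Proof.
rewrite cardE; apply/perm_size/uniq_perm; rewrite ?enum_uniq // => x.
rewrite in_fset_set ?mem_enum; last exact: finite_finset.
by apply/idP/idP; rewrite inE.
Qed.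

Lemma fsbig_const1 (R : pzSemiRingType) (T : choiceType) (A : set T) :
  finite_set A -> \sum_(x \in A) (1 : R) = (`#|A|)%:R.
Proof. by move=> finA; rewrite fsbig_finite // big_const_seq count_predT iter_addr_0. Qed.

Lemma card_fset_setX (T U : choiceType) (A : set T) (B : set U) :
  finite_set A -> finite_set B -> `#|A `*` B| = (`#|A| * `#|B|)%N.
Proof.
move=> finA finB; rewrite -[LHS]natn -fsbig_const1; last exact: finite_setX.
rewrite -(pair_fsbig _ (fun _ _ => 1)) // fsbig_const1 //.
by rewrite fsbig_finite // big_const_seq count_predT iter_addr_0 natn -mulr_natr natn mulrC.
Qed.

(** A maximal injective linear map from some F^n exists because |F^n| <= |L|, and
    maximality makes it surjective. *)
Lemma card_lmod_dimension (F : finFieldType) (L : lmodType F) :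
  finite_set [set: L] -> `#|[set: L]| = (#|F| ^ dimension L)%N.
Proof.
move=> finL.
pose P n := `[< exists g : 'rV[F]_n -> L, linear g /\ injective g >].
have card_rV n : `#|[set: 'rV[F]_n]| = (#|F| ^ n)%N.
  have -> : [set: 'rV[F]_n] = [set` predT] by rewrite eqEsubset; split.
  by rewrite card_fset_set_fin cardT -cardE card_mx mul1n.
have bound n : P n -> (n <= `#|[set: L]|)%N.
  case/asboolP=> g [_ ginj].
  have := @fsubset_leq_card _ (fset_set (g @` setT)) (fset_set setT).
  rewrite -fset_set_sub //; last exact/finite_image/finite_finset.
  move/(_ (@subsetT _ _)); rewrite (card_set_bij (A := setT) (h := g)).
  - rewrite card_rV; apply: leq_trans; apply/ltnW/ltn_expl.
    exact: card_finNzRing_gt1.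
  - exact: finite_finset.
  by split=> // x y _ _; apply: ginj.
have P0 : exists n, P n.
  exists 0%N; apply/asboolP; exists (fun=> 0); split=> [a u v|u v _].
    by rewrite scaler0 addr0.
  by rewrite [u]thinmx0 [v]thinmx0.
have [n /asboolP[g [glin ginj]] nmax] := ex_maxnP P0 bound.
have gsurj x : exists u, g u = x.
  apply: contrapT => nx; have := nmax n.+1; rewrite ltnn => /(_ _)/negP[] //.
  pose gL := GRing.isLinear.Build _ _ _ _ g glin.
  pose gl : {linear 'rV[F]_n -> L} := HB.pack g gL.
  have ggl u : g u = gl u by [].
  pose h (w : 'rV[F]_(1 + n)) := lsubmx w 0 0 *: x + g (rsubmx w).
  suff [hlin hinj] : linear h /\ injective h by apply/asboolP; exists h.
  split; first move=> a u v.
    rewrite /h; rewrite !ggl [rsubmx (_ + _)]linearP [gl (_ + _)]linearP /= !mxE.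
    by rewrite scalerDl scalerDr scalerA addrACA.
  move=> u v /eqP; rewrite -subr_eq0 /h => /eqP.
  have -> : forall a b c d : L, (a + b) - (c + d) = (a - c) + (b - d).
    by move=> a b c d; rewrite opprD addrACA.
  rewrite -scalerBl !ggl -linearB /= => e.
  have c0 : lsubmx u 0 0 - lsubmx v 0 0 = 0.
    apply/eqP/negPn/negP => c0; apply: nx.
    exists (- ((lsubmx u 0 0 - lsubmx v 0 0)^-1 *: (rsubmx u - rsubmx v))).
    rewrite ggl linearN linearZ /=; move/eqP: e; rewrite addrC addr_eq0 => /eqP ->.
    by rewrite scalerN opprK scalerA mulVf // scale1r.
  move: e; rewrite c0 scale0r add0r -(linear0 gl) -!ggl => /ginj /eqP.
  rewrite subr_eq0 => /eqP er; rewrite -[u]hsubmxK -[v]hsubmxK er; congr row_mx.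
  apply/rowP => i; rewrite !ord1; apply/eqP; rewrite -subr_eq0; exact/eqP.
have [f gK fK] : bijective g.
  pose f x := sval (cid (gsurj x)).
  have fK x : g (f x) = x by apply: (svalP (cid (gsurj x))).
  by exists f => // u; apply: ginj; rewrite fK.
have flin : linear f.
  by move=> a x y; apply: ginj; rewrite fK glin !fK.
rewrite /dimension; case: xgetP => [m -> [h [_ [h' hK h'K]]]|/(_ n) []]; last first.
  by exists f; split=> //; exists g.
rewrite -card_rV; apply/esym/(card_set_bij (h := h)) => //; split=> // [x y _ _|y _].
  exact: (can_inj hK).
by exists (h' y).
Qed.

(** * Finitely generated groups *)

Definition finitely_generated (G : groupType) : Prop :=
  exists (n : nat) (x : 'I_n -> G), forall g, exists w, eval_word x w = g.

Lemma finitely_presented_generated (G : groupType) :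
  finitely_presented G -> finitely_generated G.
Proof. by case=> n [x [R [gen _]]]; exists n, x. Qed.

Lemma finite_group_generated (gT : finGroupType) : finitely_generated gT.
Proof.
exists #|gT|, enum_val => g; exists [:: (enum_rank g, false)].
by rewrite /eval_word /= enum_rankK mulg1.
Qed.

Lemma generators_ind (G : groupType) (n : nat) (x : 'I_n -> G) (P : G -> Prop) :
    (forall g, exists w, eval_word x w = g) ->
    P 1%g -> (forall i g, P g -> P (x i * g)%g) ->
    (forall i g, P g -> P ((x i)^-1 * g)%g) ->
  forall g, P g.
Proof.
move=> gen P1 Px PV g; have [w <-] := gen g.
by elim: w => [|[i []] w IH] //=; [apply: PV | apply: Px].
Qed.

(** A homomorphism is determined by its values on finitely many generators. *)
Lemma finite_hom (G : groupType) (E : finGroupType) :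
  finitely_generated G -> finite_set [set f : G -> E | {morph f : x y / (x * y)%g}].
Proof.
case=> n [x gen].
apply: (@finite_set_inj_fin _ {ffun 'I_n -> E} _ (fun f => [ffun i => f (x i)])).
move=> f f' /set_mem /= fM /set_mem /= f'M /ffunP ff'; apply/funext.
have h1 (h : G -> E) : {morph h : x y / (x * y)%g} -> h 1%g = 1%g.
  by move=> hM; apply: (mulgI (h 1%g)); rewrite -hM !mulg1.
have hV (h : G -> E) : {morph h : x y / (x * y)%g} -> forall g, h g^-1%g = (h g)^-1%g.
  by move=> hM g; apply: (mulgI (h g)); rewrite -hM !mulgV h1.
apply: (generators_ind gen) => [|i g IH|i g IH].
- by rewrite !h1.
- by rewrite fM f'M IH; have := ff' i; rewrite !ffunE => ->.
- by rewrite fM f'M !hV // IH; have := ff' i; rewrite !ffunE => ->.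
Qed.

(** * Cocycles and the first cohomology group *)

Section Cohomology.
Variables (G : groupType) (F : finFieldType) (r : nat) (act : G -> 'M[F]_r).
Local Notation V := 'cV[F]_r.
Hypotheses (actM : forall g h, act (g * h)%g = act g *m act h)
  (act1 : act 1%g = 1%:M).

Lemma Z1P (f : G -> V) :
  reflect (forall g h, f (g * h)%g = f g + act g *m f h) (f \in Z1 act).
Proof.
apply: (iffP (asboolP _)) => fZ g h.
  apply/eqP; rewrite eq_sym -subr_eq0 addrAC addrC [_ - _]addrC addrA.
  by have := fZ g h; rewrite /delta1 -addrA addrC => /eqP.
by rewrite /delta1 fZ [f g + _]addrC opprD addrA subrr sub0r addNr.
Qed.

Lemma finite_Z1 : finitely_generated G -> finite_set [set f | f \in Z1 act].
Proof.
case=> n [x gen].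
apply: (@finite_set_inj_fin _ {ffun 'I_n -> V} _ (fun f => [ffun i => f (x i)])).
move=> f f' /set_mem /= /Z1P fM /set_mem /= /Z1P f'M /ffunP ff'; apply/funext.
have h1 (h : G -> V) : (forall g k, h (g * k)%g = h g + act g *m h k) -> h 1%g = 0.
  by move=> hM; apply: (addrI (h 1%g)); rewrite -{2}[h 1%g]mul1mx -act1 -hM mulg1 addr0.
have hV (h : G -> V) : (forall g k, h (g * k)%g = h g + act g *m h k) ->
    forall g, h g^-1%g = - (act g^-1%g *m h g).
  by move=> hM g; apply/eqP; rewrite -addr_eq0 -hM mulVg h1.
apply: (generators_ind gen) => [|i g IH|i g IH].
- by rewrite !h1.
- by rewrite fM f'M IH; have := ff' i; rewrite !ffunE => ->.
- by rewrite fM f'M !hV // IH; have := ff' i; rewrite !ffunE => ->.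
Qed.

Hypotheses (Gfg : finitely_generated G) (irr : irreducible_action act).

Lemma finite_cocycle : finite_set [set: cocycle act].
Proof.
have h : set_inj [set: cocycle act] (fun f => f : G -> V).
  by move=> f g _ _ /val_inj.
rewrite -(eq_finite_set (inj_card_eq h)); apply: sub_finite_set (finite_Z1 Gfg).
by move=> _ [f _ <-] /=; apply: (valP f).
Qed.

Lemma card_cocycle : `#|[set f | f \in Z1 act]| = `#|[set: cocycle act]|.
Proof.
apply: (card_set_bij (h := fun f : cocycle act => f : G -> V) finite_cocycle).
split=> [f _|f g _ _ /val_inj //|f fZ]; first exact: (valP f).
by exists (Cocycle fZ).
Qed.

Lemma pi_H1_eq (f g : cocycle act) : pi_H1 f = pi_H1 g <-> f - g \in B1 (act:=act).
Proof.
by rewrite Quotient.idealrBE; split=> [e|/eqP e]; [apply/eqP | ].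
Qed.

Lemma pi_H1_repr (x : H1 act) : pi_H1 (generic_quotient.repr x : cocycle act) = x.
Proof. exact: generic_quotient.reprK. Qed.

(** Subtracting the chosen representative of its class turns a cocycle into a
    pair of a coboundary and a class. *)
Lemma card_cocycle_H1 :
  `#|[set: cocycle act]| = (`#|[set f | f \in B1 (act:=act)]| * #|F| ^ dimension (H1 act))%N.
Proof.
have finH : finite_set [set: H1 act].
  apply: sub_finite_set (finite_image (@pi_H1 _ _ _ act) finite_cocycle) => x _.
  by exists (generic_quotient.repr x : cocycle act) => //; apply: pi_H1_repr.
rewrite -card_lmod_dimension // -card_fset_setX //; last first.
  exact: sub_finite_set (@subsetT _ _) finite_cocycle.
apply/esym/(card_set_bij (h := fun f : cocycle act =>
  (f - (generic_quotient.repr (pi_H1 f) : cocycle act), pi_H1 f)) finite_cocycle).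
split=> [f _|f g _ _ e|[b x] [/= bB _]].
- by split=> //=; apply/pi_H1_eq; rewrite pi_H1_repr.
- have /= e2 := congr1 snd e; have /= := congr1 fst e.
  by rewrite e2 => /addIr.
have e : pi_H1 (b + (generic_quotient.repr x : cocycle act)) = x.
  by rewrite -[RHS]pi_H1_repr; apply/pi_H1_eq; rewrite addrK.
exists (b + (generic_quotient.repr x : cocycle act)) => //.
by rewrite e addrK.
Qed.

(** The coboundary map V -> B1 is injective unless V has nonzero fixed vectors,
    in which case irreducibility makes V trivial and B1 zero. *)
Lemma card_B1 :
  `#|[set f | f \in B1 (act:=act)]| = (#|{: V}| ^ (~~ `[< forall g (v : V), act g *m v = v >]))%N.
Proof.
case: asboolP => [triv|ntriv] /=; rewrite ?expn0 ?expn1.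
  have -> : [set f | f \in B1 (act:=act)] = [set (0 : cocycle act)].
    rewrite eqEsubset; split=> [f /asboolP[v fv]|_ ->] /=; last exact: rpred0.
    by apply/val_inj/funext => g; rewrite /= fv triv subrr.
  by rewrite fset_set1 cardfs1.
have [//|fix0] := fixed_vectors_irreducible irr.
have dZ (v : V) : (fun g => act g *m v - v) \in Z1 act.
  by apply/Z1P => g h; rewrite actM mulmxBr mulmxA [RHS]addrC addrA subrK.
have -> : #|{: V}| = `#|[set: V]|.
  have -> : [set: V] = [set` predT] by rewrite eqEsubset; split.
  by rewrite card_fset_set_fin.
apply: (card_set_bij (h := fun v => Cocycle (dZ v))); first exact: finite_finset.
split=> [v _|u v _ _ [e]|f /asboolP[v fv]].
- by apply/asboolP; exists v.
- apply/eqP; rewrite -subr_eq0; apply/eqP/fix0 => g.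
  have := congr1 (@^~ g) e; rewrite /= mulmxBr -{2}(subrK u (act g *m u)) => ->.
  by rewrite [LHS]addrC -addrA addKr addrC.
by exists v => //; apply/val_inj/funext => g; rewrite /= fv.
Qed.

Lemma card_Z1 :
  `#|[set f | f \in Z1 act]| =
  (#|{: V}| ^ (~~ `[< forall g (v : V), act g *m v = v >])
   * #|F| ^ dimension (H1 act))%N.
Proof. by rewrite card_cocycle card_cocycle_H1 card_B1. Qed.

End Cohomology.

(** * Lifting homomorphisms through an extension with irreducible kernel *)

Section Lifts.
Variables (E B : finGroupType) (F : finFieldType) (r : nat).
Local Notation V := 'cV[F]_r.
Variables (pi : E -> B) (iota : V -> E) (sec : B -> E).
Variables (sigma : B -> 'M[F]_r) (chi : B -> B -> V).
Hypotheses (piM : {morph pi : x y / (x * y)%g})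
  (iotaD : {morph iota : u v / u + v >-> (u * v)%g}) (iota_inj : injective iota)
  (iota_im : range iota = [set x | pi x = 1%g])
  (secK : forall b, pi (sec b) = b)
  (sigmaE : forall b a, iota (sigma b *m a) = (sec b * iota a * (sec b)^-1)%g)
  (chiE : forall b b', iota (chi b b') = (sec b * sec b' * (sec (b * b'))^-1)%g).

Let iota0 : iota 0 = 1%g.
Proof. by apply: (mulgI (iota 0)); rewrite -iotaD addr0 mulg1. Qed.

Let iotaN v : iota (- v) = (iota v)^-1%g.
Proof. by apply: (mulgI (iota v)); rewrite -iotaD subrr iota0 mulgV. Qed.

Let iotaC u v : (iota u * iota v = iota v * iota u)%g.
Proof. by rewrite -!iotaD addrC. Qed.

Let pi_iota v : pi (iota v) = 1%g.
Proof.
have : range iota (iota v) by exists v.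
by rewrite iota_im.
Qed.

Let ker_iota x : pi x = 1%g -> exists v, iota v = x.
Proof.
move=> x1; have [v _ <-] : range iota x by rewrite iota_im.
by exists v.
Qed.

Let pi1 : pi 1%g = 1%g.
Proof. by apply: (mulgI (pi 1%g)); rewrite -piM !mulg1. Qed.

Let piV x : pi x^-1%g = (pi x)^-1%g.
Proof. by apply: (mulgI (pi x)); rewrite -piM !mulgV pi1. Qed.

(** The kernel is abelian, so conjugation on it depends only on the image in B and
    not on the section. *)
Lemma iota_conj x a : iota (sigma (pi x) *m a) = (x * iota a * x^-1)%g.
Proof.
have [u e] : exists u, iota u = (x * (sec (pi x))^-1)%g.
  by apply: ker_iota; rewrite piM piV secK mulgV.
have -> : x = (iota u * sec (pi x))%g by rewrite e mulgKV.
rewrite piM secK pi_iota mul1g sigmaE invMg !mulgA -(mulgA (iota u)) -(mulgA (iota u)).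
by rewrite -sigmaE iotaC mulgK.
Qed.

Lemma monodromyM b b' : sigma (b * b')%g = sigma b *m sigma b'.
Proof.
apply/trmx_inj/row_matrixP => i; apply/trmx_inj; rewrite !tr_row !trmxK !colE.
apply: iota_inj; rewrite -mulmxA -{1}(secK b) -{1}(secK b') -piM !iota_conj !sigmaE.
by rewrite invMg !mulgA.
Qed.

Lemma monodromy1 : sigma 1%g = 1%:M.
Proof.
apply/trmx_inj/row_matrixP => i; apply/trmx_inj; rewrite !tr_row !trmxK !colE.
by apply: iota_inj; rewrite mul1mx -pi1 iota_conj mul1g invg1 mulg1.
Qed.

Definition lifts (G : groupType) (rho : G -> B) : set (G -> E) :=
  [set f | {morph f : x y / (x * y)%g} /\ forall g, pi (f g) = rho g].

Section Domain.
Variables (G : groupType) (rho : G -> B).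
Hypotheses (rhoM : {morph rho : x y / (x * y)%g}).

(** Every map lifting rho has the form g |-> iota (f g) * sec (rho g); expanding
    the product of two values shows that it is multiplicative exactly when f
    solves the displayed equation. *)
Lemma obstruction_vanishes :
  (exists f : G -> V, forall g h,
     delta1 (sigma \o rho) f g h = - chi (rho g) (rho h)) <->
  exists f, lifts rho f.
Proof.
split=> [[f fP]|[f [fM fpi]]].
  exists (fun g => iota (f g) * sec (rho g))%g; split=> [g h|g]; last first.
    by rewrite piM pi_iota mul1g secK.
  have -> : f (g * h)%g = f g + sigma (rho g) *m f h + chi (rho g) (rho h).
    rewrite -[chi _ _]opprK -fP /delta1 /= opprD opprB.
    by rewrite [RHS]addrC -addrA addKr subrK.
  by rewrite rhoM !iotaD chiE sigmaE /= !mulgA !mulgKV.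
have exa g : exists v, iota v = (f g * (sec (rho g))^-1)%g.
  by apply: ker_iota; rewrite piM piV secK fpi mulgV.
pose a g := sval (cid (exa g)).
have aE g : iota (a g) = (f g * (sec (rho g))^-1)%g by apply: (svalP (cid (exa g))).
clearbody a; exists a => g h; rewrite /delta1 /=.
have -> : a (g * h)%g = a g + sigma (rho g) *m a h + chi (rho g) (rho h).
  by apply: iota_inj; rewrite !iotaD chiE sigmaE !aE fM rhoM !mulgA !mulgKV.
rewrite [a g + _]addrC -[X in _ - X]addrA opprD addrA subrr sub0r.
by rewrite opprD addrC addrA subrr sub0r.
Qed.

(** The quotient of two lifts takes its values in the kernel, and it is a cocycle
    because conjugation by a lift of rho g is the action of g. *)
Lemma lifts_torsor f0 : lifts rho f0 ->
  set_bij [set z | z \in Z1 (sigma \o rho)] (lifts rho)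
    (fun z g => iota (z g) * f0 g)%g.
Proof.
move=> [f0M f0pi]; split=> [z /= /Z1P zM|z z' _ _ zz'|f [fM fpi]].
- split=> [g h|g]; last by rewrite piM pi_iota mul1g.
  by rewrite zM iotaD f0M /= -f0pi iota_conj !mulgA mulgKV.
- by apply/funext => g; apply/iota_inj/(mulIg (f0 g))/(congr1 (@^~ g) zz').
have exz g : exists v, iota v = (f g * (f0 g)^-1)%g.
  by apply: ker_iota; rewrite piM piV fpi f0pi mulgV.
pose z g := sval (cid (exz g)).
have zE g : iota (z g) = (f g * (f0 g)^-1)%g by apply: (svalP (cid (exz g))).
clearbody z; exists z; last by apply/funext => g; rewrite zE mulgKV.
apply/Z1P => g h; apply: iota_inj.
by rewrite iotaD /= -f0pi iota_conj !zE fM f0M invMg !mulgA mulgKV.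
Qed.

Lemma card_lifts : finite_set [set z | z \in Z1 (sigma \o rho)] ->
  `#|lifts rho| =
  (`[< exists f : G -> V, forall g h,
         delta1 (sigma \o rho) f g h = - chi (rho g) (rho h) >]
   * `#|[set z | z \in Z1 (sigma \o rho)]|)%N.
Proof.
move=> finZ; case: asboolP => [/obstruction_vanishes[f0 f0l]|no]; last first.
  rewrite mul0n; have -> : lifts rho = set0; last by rewrite fset_set0 cardfs0.
  by apply/eqP/negPn/negP => /set0P[f fl]; apply/no/obstruction_vanishes; exists f.
by rewrite mul1n (card_set_bij finZ (lifts_torsor f0l)).
Qed.

Hypotheses (irr : irreducible_action sigma) (V_neq0 : exists v : V, v != 0)
  (rho_onto : forall b, exists g, rho g = b).

(** Lifts of the identity of B are the splittings of the extension. The image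
    of a lift of rho meets the kernel in a submodule: if this is the whole kernel
    the lift is onto, and if it is zero the lift factors through rho, as a
    splitting composed with rho. *)
Lemma nonsurjective_lifts :
  set_bij (lifts (idfun : B -> B)) (lifts rho `\` [set f | range f = setT])
    (fun t => t \o rho).
Proof.
split=> [t [tM tpi]|t t' _ _ tt'|f [[fM fpi] fN]].
- split; first by split=> [g h|g] /=; rewrite ?rhoM ?tM ?tpi.
  move=> tT; have [v v0] := V_neq0.
  have [g _ /= e] : range (t \o rho) (iota v) by rewrite tT.
  have rg : rho g = 1%g by have /= := tpi (rho g); rewrite e pi_iota.
  have t1 : t 1%g = 1%g by apply: (mulgI (t 1%g)); rewrite -tM !mulg1.
  by case/eqP: v0; apply: iota_inj; rewrite -e rg t1 iota0.
- apply/funext => b; have [g <-] := rho_onto b.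
  exact: (congr1 (@^~ g) tt').
have f1 : f 1%g = 1%g by apply: (mulgI (f 1%g)); rewrite -fM !mulg1.
have fV g : f g^-1%g = (f g)^-1%g by apply: (mulgI (f g)); rewrite -fM !mulgV f1.
pose W := finset (fun v => `[< exists g, f g = iota v >]).
have inW v : reflect (exists g, f g = iota v) (v \in W) by rewrite inE; apply: asboolP.
have [|||W0|WT] := irr (W := W).
- by apply/inW; exists 1%g; rewrite f1 iota0.
- move=> u v /inW[g gu] /inW[h hv]; apply/inW; exists (g * h^-1)%g.
  by rewrite fM fV gu hv iotaD iotaN.
- move=> b v /inW[h hv]; have [g <-] := rho_onto b; apply/inW.
  by exists (g * h * g^-1)%g; rewrite -fpi iota_conj !fM fV hv.
- pose s b := sval (cid (rho_onto b)).
  have sK b : rho (s b) = b by apply: (svalP (cid (rho_onto b))).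
  have fE g h : rho g = rho h -> f g = f h.
    move=> e; have [v ve] : exists v, iota v = f (g * h^-1)%g.
      by apply: ker_iota; rewrite fM fV piM piV !fpi e mulgV.
    have : v \in W by apply/inW; exists (g * h^-1)%g.
    rewrite W0 inE => /eqP v0; move: ve; rewrite v0 iota0 fM fV => /esym/eqP.
    by rewrite -eq_mulgV1 => /eqP.
  exists (f \o s); last by apply/funext => g /=; apply: fE; rewrite sK.
  split=> [b c|b] /=; last by rewrite fpi sK.
  by rewrite -fM; apply: fE; rewrite rhoM !sK.
case: fN; rewrite /= eqEsubset; split=> // x _.
have [g ge] := rho_onto (pi x).
have [v ve] : exists v, iota v = (x * (f g)^-1)%g.
  by apply: ker_iota; rewrite piM piV fpi ge mulgV.
have /inW[h hv] : v \in W by rewrite WT inE.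
by exists (h * g)%g => //; rewrite fM hv ve mulgKV.
Qed.

End Domain.

Lemma card_surjective_lifts (G : groupType) (rho : G -> B) :
    {morph rho : x y / (x * y)%g} -> (forall b, exists g, rho g = b) ->
    irreducible_action sigma -> (exists v : V, v != 0) -> finite_set (lifts rho) ->
  (`#|lifts rho `&` [set f | range f = setT]| + `#|lifts (idfun : B -> B)|)%N =
  `#|lifts rho|.
Proof.
move=> rhoM rho_onto irr V0 finL.
have finT : finite_set (lifts (idfun : B -> B)).
  by apply: sub_finite_set (finite_hom E (finite_group_generated B)) => f [].
rewrite -(card_set_bij finT (nonsurjective_lifts rhoM irr V0 rho_onto)).
set L := lifts rho; set S := [set f | _].
have finLS : finite_set (L `&` S) by apply: finite_setIl.
have -> : L `\` S = L `\` (L `&` S) by rewrite setDIr setDv set0U.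
rewrite -(cardfsID (fset_set (L `&` S)) (fset_set L)) -fset_setI // -fset_setD //.
by rewrite setIA setIid.
Qed.
End Lifts.

(** * Chief series *)

Section Projections.
Variables (gT : finGroupType) (K H : {group gT}).
Hypotheses (nK : (K <| [set: gT]%G)%g) (nH : (H <| [set: gT]%G)%g) (sKH : K \subset H).

Lemma in_normal_setT x : x \in 'N(K)%g.
Proof. by rewrite (fintype.subsetP (normal_norm nK)) // finset.inE. Qed.

(** [qproj] is defined by a choice of representatives, which is immaterial because
    K is contained in H. *)
Lemma qproj_coset x : qproj H (coset K x) = coset H x.
Proof.
have : repr (coset K x) \in (K :* x)%g.
  by rewrite -val_coset ?in_normal_setT // mem_repr_coset.
case/rcosetP => k Kk; rewrite /qproj => ->.
have Hx y : y \in 'N(H)%g by rewrite (fintype.subsetP (normal_norm nH)) // finset.inE.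
by rewrite morphM //= (coset_id (fintype.subsetP sKH _ Kk)) mul1g.
Qed.

Lemma qprojM : {morph @qproj gT K H : x y / (x * y)%g}.
Proof.
move=> a b; have [x Nx ->] := cosetP a; have [y Ny ->] := cosetP b.
have Hx z : z \in 'N(H)%g by rewrite (fintype.subsetP (normal_norm nH)) // finset.inE.
by rewrite -morphM //= !qproj_coset morphM.
Qed.

Lemma qproj_eq1 (a : coset_of K) : qproj H a = 1%g <-> a \in (H / K)%g.
Proof.
have [x Nx ->] := cosetP a.
have Hx z : z \in 'N(H)%g by rewrite (fintype.subsetP (normal_norm nH)) // finset.inE.
rewrite qproj_coset; split=> [/coset_idr-/(_ (Hx x))|]; first exact: mem_quotient.
case/morphimP => y Ny Hy e; have := qproj_coset y.
by rewrite /= -e qproj_coset => ->; apply: coset_id.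
Qed.
End Projections.

Section ChiefSeries.
Variables (gT : finGroupType) (nu : nat) (Gam : nat -> {group gT}).
Hypothesis Gam_chief : chief_series nu Gam.
Local Notation B i := (coset_of (Gam i)).
Local Notation E i := (Gam i / Gam i.+1)%g.

Lemma chief_series_normal i : (i <= nu.+1)%N -> (Gam i <| [set: gT]%G)%g.
Proof.
have [_ G1 ch] := Gam_chief; rewrite leq_eqVlt => /predU1P[->|/ch/andP[]//].
by rewrite G1 normal1.
Qed.

Lemma chief_series_proper i : (i <= nu)%N -> Gam i.+1 \proper Gam i.
Proof.
have [_ _ ch] := Gam_chief; move=> /ch /andP[/maxgroupp/andP[] //].
Qed.

Lemma chief_series_sub i j : (i <= j <= nu.+1)%N -> Gam j \subset Gam i.
Proof.
elim: j => [|j IH]; first by rewrite leqn0 andbT => /eqP->.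
rewrite leq_eqVlt; case/andP => /predU1P[->//|ij] jn.
apply: fintype.subset_trans (IH _); last by rewrite -ltnS ij ltnW.
by apply/proper_sub/chief_series_proper.
Qed.

Section TopFactor.
Variables (p r : nat).
Hypothesis p_pr : prime p.
Local Notation V := 'cV['F_p]_r.
Variables (iota : V -> B nu.+1) (sec : B nu -> B nu.+1).
Variables (sigma : B nu -> 'M['F_p]_r) (chi : B nu -> B nu -> V).
Hypotheses (iotaD : {morph iota : u v / u + v >-> (u * v)%g})
  (iota_inj : injective iota) (iota_im : range iota = [set x | x \in E nu])
  (secK : forall b, qproj (Gam nu) (sec b) = b)
  (sigmaE : forall b a, iota (sigma b *m a) = (sec b * iota a * (sec b)^-1)%g)
  (chiE : forall b b', iota (chi b b') = (sec b * sec b' * (sec (b * b'))^-1)%g).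

Let nE : (Gam nu.+1 <| [set: gT]%G)%g.
Proof. exact: chief_series_normal. Qed.

Let nB : (Gam nu <| [set: gT]%G)%g.
Proof. exact: chief_series_normal. Qed.

Let sEB : Gam nu.+1 \subset Gam nu.
Proof. by apply: chief_series_sub; rewrite leqnSn leqnn. Qed.

Lemma top_projM :
  {morph @qproj gT (Gam nu.+1) (Gam nu) : x y / (x * y)%g}.
Proof. exact: qprojM. Qed.

Lemma top_kernel : range iota = [set x : B nu.+1 | qproj (Gam nu) x = 1%g].
Proof.
by rewrite iota_im eqEsubset; split=> x /(qproj_eq1 nE nB sEB).
Qed.

Let sigmaM := monodromyM top_projM iotaD iota_inj top_kernel secK sigmaE.
Let sigma1 := monodromy1 top_projM iotaD iota_inj top_kernel secK sigmaE.
Let conjE := iota_conj top_projM iotaD top_kernel secK sigmaE.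

Lemma iota_top v : iota v \in E nu.
Proof. by have : range iota (iota v) by [exists v]; rewrite iota_im. Qed.

Lemma card_top : #|E nu| = #|{: V}|.
Proof.
rewrite -(card_codom iota_inj); apply: eq_card => x.
apply/idP/codomP => [xE|[v ->]]; last exact: iota_top.
by have [v _ <-] : range iota x by [rewrite iota_im]; exists v.
Qed.

Let iota1 : iota 0 = 1%g.
Proof. by apply: (mulgI (iota 0)); rewrite -iotaD addr0 mulg1. Qed.

Lemma top_neq0 : exists v : V, v != 0.
Proof.
apply: contrapT => no; have /andP[_ /negP[]] := chief_series_proper (leqnn nu).
apply/fintype.subsetP => x Nx.
have [v _ e] : range iota (coset (Gam nu.+1) x) by rewrite iota_im /= mem_quotient.
apply: coset_idr; first by rewrite in_normal_setT.
by rewrite -e -iota1; congr (iota _); apply: contrapT => v0; apply: no; exists v; apply/eqP.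
Qed.

Lemma top_irreducible : irreducible_action sigma.
Proof.
move=> W W0 WB Wact.
have [_ _ /(_ nu (leqnn nu)) ch] := Gam_chief.
have /mingroupP[_ minE] := chief_factor_minnormal ch.
have W_group : group_set [set iota v | v in W]%SET.
  apply/group_setP; split; first by rewrite -iota1 imset_f.
  move=> _ _ /imsetP[u Wu ->] /imsetP[v Wv ->]; rewrite -iotaD imset_f //.
  by rewrite -[v]opprK -[- v]sub0r WB // WB.
have [W1|Wn1] := eqVneq (Group W_group :> {set _}) 1%g.
  left; apply/setP => v; rewrite finset.in_set1; apply/idP/eqP => [Wv|-> //].
  apply: iota_inj; rewrite iota1; apply/set1gP; rewrite -W1; exact: imset_f.
right; apply/setP => v; rewrite finset.in_setT.
have := iota_top v; rewrite -(minE (Group W_group)).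
- by case/imsetP => w Ww /iota_inj ->.
- apply/andP; split => //; apply/fintype.subsetP => x _; rewrite finset.inE.
  apply/fintype.subsetP => _ /imsetP[_ /imsetP[w Ww ->] ->].
  by rewrite conjgE -{2}[x]invgK mulgA -conjE imset_f // Wact.
by apply/fintype.subsetP => _ /imsetP[w Ww ->]; apply: iota_top.
Qed.

Definition lifted_action (x : gT) : 'M['F_p]_r := sigma (coset (Gam nu) x).
Local Notation act := lifted_action.

Let inN i x : (i <= nu.+1)%N -> x \in 'N(Gam i)%g.
Proof. by move=> /chief_series_normal /in_normal_setT. Qed.

Lemma lifted_actionM x y : act (x * y)%g = act x *m act y.
Proof. by rewrite /act morphM ?inN // sigmaM. Qed.

Lemma lifted_action1 : act 1%g = 1%:M.
Proof. by rewrite /act morph1 sigma1. Qed.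

Lemma lifted_action_irreducible : irreducible_action act.
Proof.
move=> W W0 WB Wact; apply: top_irreducible => // b v Wv.
by have [x _ ->] := cosetP b; apply: Wact.
Qed.

Lemma lifted_action_conj x v :
  iota (act x *m v) = (coset (Gam nu.+1) x * iota v * (coset (Gam nu.+1) x)^-1)%g.
Proof.
by rewrite -conjE qproj_coset.
Qed.

Local Notation Z N := (cocycles_vanishing act N).

Definition split_top_factor i : bool :=
  complemented_factor Gam i && `[< module_isomorphic_top Gam nu i >].

Lemma top_qproj i x : (i <= nu)%N ->
  qproj (Gam i.+1) (coset (Gam nu.+1) x) = coset (Gam i.+1) x.
Proof.
move=> le_in; apply: qproj_coset => //; first exact: chief_series_normal.
by apply: chief_series_sub; rewrite ltnS le_in leqnn.
Qed.

(** E i is abelian because E nu is, so Gam i centralizes it, and the isomorphism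
    carries this over to E nu. *)
Lemma module_isomorphic_acts_trivially i : (i <= nu)%N ->
  module_isomorphic_top Gam nu i ->
  acts_trivially act (Gam i) /\ abelian (E i).
Proof.
move=> le_in [f [/isomP[finj fim] fconj]].
have abE : abelian (E i).
  apply/centsP => a Ea b Eb; apply: (injmP finj); rewrite ?groupM // !morphM //.
  have im c : c \in E i -> exists v, f c = iota v.
    move=> Ec; have : f c \in E nu by rewrite -fim mem_morphim.
    move=> fc; have [v _ <-] : range iota (f c) by rewrite iota_im.
    by exists v.
  have [u ->] := im a Ea; have [v ->] := im b Eb.
  by rewrite /= -!iotaD addrC.
split=> // n v Nn; apply: iota_inj; rewrite lifted_action_conj.
have := iota_top v; rewrite -fim => /morphimP[a Ea _ /= ->].
rewrite -fconj // top_qproj //.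
congr (f _); have cE : coset (Gam i.+1) n \in E i by apply: mem_quotient.
by rewrite (centsP abE _ cE _ Ea) mulgK.
Qed.

(** Given a complement C of E i and an isomorphism phi from E i to E nu, the
    cocycle is phi of the E i-component in the factorization E i * C. *)
Lemma cocycle_of_split_top_factor i : (i <= nu)%N -> split_top_factor i ->
  exists2 f, f \in Z (Gam i.+1) & exists2 n, n \in Gam i & f n != 0.
Proof.
move=> le_in /andP[/splitsP[C /complP[tiEC EC]] /asboolP iso].
have [_ abE] := module_isomorphic_acts_trivially le_in iso.
have [phi [/isomP[phi_inj phi_im] phi_conj]] := iso.
pose iv (b : B nu.+1) : V := odflt 0 [pick v | iota v == b].
have ivE a : a \in E i -> iota (iv (phi a)) = phi a.
  move=> Ea; have : phi a \in E nu by rewrite -phi_im mem_morphim.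
  move=> fa; have [v _ e] : range iota (phi a) by rewrite iota_im.
  rewrite /iv; case: pickP => [w /eqP //|/(_ v)].
  by rewrite e eqxx.
pose c x := coset (Gam i.+1) x.
pose d x := divgr (E i) C (c x).
pose k x := remgr (E i) C (c x).
have cEC x : c x \in (E i * C)%g by rewrite EC mem_quotient // finset.inE.
have dE x : d x \in E i by apply: mem_divgr.
have kC x : k x \in C by apply: mem_remgr.
have cdk x : c x = (d x * k x)%g by apply: divgr_eq.
have NE b a : a \in E i -> (b * a * b^-1)%g \in E i.
  have [y _ ->] := cosetP b.
  have := quotient_normal (Gam i.+1) (chief_series_normal (leqW le_in)).
  case/andP => _ /fintype.subsetP /(_ (c y)^-1%g).
  rewrite groupV mem_quotient ?finset.in_setT // => /(_ isT) nEy Ea.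
  by have := memJ_norm a nEy; rewrite conjgE invgK mulgA Ea.
have dM x y : d (x * y)%g = (d x * (c x * d y * (c x)^-1))%g.
  set w := (k x * d y * (k x)^-1)%g; have Ew : w \in E i by apply: NE.
  have -> : (c x * d y * (c x)^-1)%g = w.
    rewrite -[RHS](mulgK (d x)) -(centsP abE _ (dE x) _ Ew).
    have conjM (u v z : B i.+1) :
        (u * v * z * (u * v)^-1 = u * (v * z * v^-1) * u^-1)%g.
      by rewrite invMg !mulgA.
    by rewrite cdk conjM.
  have -> : d (x * y)%g = divgr (E i) C (d x * w * (k x * k y))%g.
    rewrite /d /c morphM ?inN //= -/(c x) -/(c y) {1}(cdk x) {1}(cdk y).
    have shift (u v z t : B i.+1) :
        (u * v * (z * t) = u * (v * z * v^-1) * (v * t))%g.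
      by rewrite !mulgA mulgKV.
    by rewrite shift.
  by apply: divgrMid => //; apply: groupM => //.
pose f : {ffun gT -> V} := [ffun x => iv (phi (d x))].
have fE x : iota (f x) = phi (d x) by rewrite ffunE ivE.
exists f.
  apply/cocycles_vanishingP; split=> [x y|x Mx]; apply: iota_inj.
    rewrite iotaD lifted_action_conj !fE dM morphM ?NE //.
    by rewrite -phi_conj // top_qproj.
  rewrite fE /d /c coset_id // -[1%g]mulg1 divgrMid ?group1 // morph1.
  exact/esym/iota1.
have /properP[_ [n Nn Mn]] := chief_series_proper le_in.
exists n => //; apply: contraNneq Mn => fn0.
have cE : c n \in E i by apply: mem_quotient.
have : phi (d n) = 1%g by rewrite -fE fn0 iota1.
rewrite /d -[c n]mulg1 divgrMid ?group1 // => phi1.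
apply: coset_idr; first by rewrite inN.
by apply: (injmP phi_inj); rewrite ?group1 // morph1.
Qed.

(** The zeros of f form a complement of Gam i modulo Gam i.+1, and f itself
    induces the isomorphism from E i to E nu. *)
Lemma split_top_factor_of_cocycle i : (i <= nu)%N -> acts_trivially act (Gam i) ->
  (exists2 f, f \in Z (Gam i.+1) & exists2 n, n \in Gam i & f n != 0) ->
  split_top_factor i.
Proof.
move=> le_in tN [f fZ f0].
have nM : (Gam i.+1 <| [set: gT]%G)%g by apply: chief_series_normal.
have nN : (Gam i <| [set: gT]%G)%g by apply/chief_series_normal/leqW.
have sMN : Gam i.+1 \subset Gam i by apply/proper_sub/chief_series_proper.
have [_ _ /(_ i le_in) ch] := Gam_chief.
have [fD fM] := cocycles_vanishingP _ _ _ fZ.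
have f1 := cocycle_at1 lifted_action1 fD.
have onto := cocycle_onto lifted_actionM lifted_action1 lifted_action_irreducible nN tN fZ f0.
have ker := cocycle_kernel lifted_actionM lifted_action1 nN sMN tN ch fZ f0.
have fDN x y : x \in Gam i -> f (x * y)%g = f x + f y by move=> Nx; rewrite fD tN.
have fVN x : x \in Gam i -> f x^-1%g = - f x.
  by move=> Nx; apply/eqP; rewrite -addr_eq0 addrC -fDN // mulgV f1.
apply/andP; split.
  have K_group : group_set (finset (fun x => f x == 0)).
    apply/group_setP; split=> [|x y]; first by rewrite finset.inE f1 eqxx.
    by rewrite !finset.inE fD => /eqP-> /eqP->; rewrite mulmx0 addr0.
  pose K := Group K_group.
  have sMK : Gam i.+1 \subset K.
    by apply/fintype.subsetP => x Mx; rewrite finset.inE fM.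
  apply/splitsP; exists (K / Gam i.+1)%G; apply/complP; split.
    rewrite -quotientIG //; apply/trivgP/fintype.subsetP => _ /morphimP[x Nx + ->].
    rewrite !finset.inE => /andP[Gx /eqP fx].
    by rewrite /= coset_id ?group1 //; apply: ker.
  rewrite -quotientMl; last first.
    exact: fintype.subset_trans (finset.subsetT _) (normal_norm nM).
  suff -> : (Gam i * K)%g = [set: gT]%G by [].
  apply/setP => x; rewrite finset.in_setT.
  have [n Nn fn] := onto (f x).
  apply/mulsgP; exists n (n^-1 * x)%g; rewrite ?mulKVg //.
  by rewrite finset.inE fDN ?groupV // fVN // fn addNr.
apply/asboolP.
pose phi (a : B i.+1) := iota (f (repr a)).
have phiE x : phi (coset (Gam i.+1) x) = iota (f x).
  by rewrite /phi (cocycle_constant_coset _ nM fZ).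
have phiM : {in E i &, {morph phi : a b / (a * b)%g}}.
  move=> _ _ /morphimP[x Nx Gx ->] /morphimP[y Ny Gy ->].
  by rewrite /= -morphM // !phiE fDN // iotaD.
exists (Morphism phiM); split.
  apply/isomP; split.
    apply/injmP => _ _ /morphimP[x Nx Gx ->] /morphimP[y Ny Gy ->] /=.
    rewrite !phiE => /iota_inj fxy; apply/eqP; rewrite eq_mulVg1 -morphV // -morphM ?groupV //=.
    by apply/eqP/coset_id/ker; rewrite ?groupM ?groupV // fDN ?groupV // fVN // fxy addNr.
  apply/setP => b; apply/morphimP/idP => [[a _ _ ->]|Eb]; first exact: iota_top.
  have [v _ <-] : range iota b by rewrite iota_im.
  have [n Nn <-] := onto v.
  by exists (coset (Gam i.+1) n); rewrite ?mem_quotient //= phiE.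
move=> b a; have [x _ ->] := cosetP b; move=> /morphimP[n Nn Gn ->] /=.
rewrite top_qproj //= -morphV ?inN // -!morphM ?inN ?groupM ?groupV ?inN //= !phiE.
by rewrite (cocycle_conj lifted_actionM lifted_action1 tN _ fZ) // lifted_action_conj.
Qed.

Lemma split_top_factor_trivial i : (i <= nu)%N -> split_top_factor i ->
  acts_trivially act (Gam i).
Proof.
by move=> le_in /andP[_ /asboolP iso]; have [] := module_isomorphic_acts_trivially le_in iso.
Qed.

Hypothesis (factor_primary : forall i, (i <= nu)%N ->
  exists l k, prime l /\ #|E i| = (l ^ k)%N).

Lemma acts_trivially_chief i j : (i <= j <= nu.+1)%N ->
  acts_trivially act (Gam i) -> acts_trivially act (Gam j).
Proof.
by move=> ij ti x v xj; apply: ti; apply: fintype.subsetP xj; apply: chief_series_sub.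
Qed.

(** As j grows, the cocycles vanishing on Gam j stay zero as long as Gam j acts
    nontrivially. At the step from nontrivial to trivial action, if there is
    one, exactly the coboundaries appear: the factor E j acts nontrivially, so it is
    not a p-group. Each later factor multiplies the count by the order of End(E nu)
    if it is complemented and isomorphic to E nu, and by 1 otherwise. *)
Lemma card_cocycles_chief_series j : (j <= nu)%N ->
  #|Z (Gam j)| =
  (#|{: V}| ^ (`[< acts_trivially act (Gam j) >] && ~~ `[< acts_trivially act (Gam 0) >])
   * #|equivariant_endomorphisms act| ^ \sum_(i < j) split_top_factor i)%N.
Proof.
have nG i : (i <= nu.+1)%N -> (Gam i <| [set: gT]%G)%g by apply: chief_series_normal.
elim: j => [_|j IH lt_jn].
  rewrite andbN big_ord0 !expn0; apply/eqP/cards1P; exists 0; apply/setP => f.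
  apply/idP/set1P => [/cocycles_vanishingP[_ f0]|->]; last exact: zero_cocycle_vanishing.
  have [G0 _ _] := Gam_chief.
  by apply/ffunP => x; rewrite ffunE f0 // G0 finset.in_setT.
have le_jn := ltnW lt_jn.
have sj : Gam j.+1 \subset Gam j by apply/proper_sub/chief_series_proper.
have nj : (Gam j <| [set: gT]%G)%g by apply/nG/leqW.
have nj1 : (Gam j.+1 <| [set: gT]%G)%g by apply/nG/leqW.
have sum0 : ~ acts_trivially act (Gam j) ->
    (\sum_(i < j.+1) split_top_factor i = 0)%N.
  move=> ntj; apply: big1 => i _; apply/eqP; rewrite eqb0; apply/negP => spl.
  have le_ij : (i <= j)%N by rewrite -ltnS.
  apply/ntj/(acts_trivially_chief (i := i)); first by rewrite le_ij leqW.
  exact: split_top_factor_trivial (leq_trans le_ij le_jn) spl.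
have [tj1|ntj1] := pselect (acts_trivially act (Gam j.+1)); last first.
  rewrite cocycles_vanishing_nontrivial ?cards1 //=; first last.
  - exact: lifted_action_irreducible.
  - exact: lifted_actionM.
  rewrite (asboolF ntj1) sum0 // => tj; apply: ntj1.
  by apply: acts_trivially_chief tj; rewrite leqnSn ltnW.
have [tj|ntj] := pselect (acts_trivially act (Gam j)).
  rewrite big_ord_recr /= expnD mulnA asboolT // -[X in (X && _)](asboolT tj) -IH //.
  have [_ _ /(_ j le_jn) ch] := Gam_chief.
  have [/cocycle_of_split_top_factor-/(_ le_jn)[f fZ f0]|nspl] := boolP (split_top_factor j).
    rewrite expn1; apply: card_cocycles_vanishing_split fZ f0 => //.
    - exact: lifted_actionM.
    - exact: lifted_action1.
    - exact: lifted_action_irreducible.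
  rewrite expn0 muln1; apply/eq_card => f; apply/idP/idP => [fZ|]; last first.
    exact: cocycles_vanishingS.
  have [fD _] := cocycles_vanishingP _ _ _ fZ.
  apply/cocycles_vanishingP; split=> // n Nn; apply/eqP/negPn/negP => fn.
  case/negP: nspl; apply: split_top_factor_of_cocycle => //.
  by exists f => //; exists n.
have nt0 : ~ acts_trivially act (Gam 0).
  by move=> t0; apply: ntj; apply: acts_trivially_chief t0; rewrite leqW.
rewrite sum0 // asboolT // asboolF // expn1 expn0 muln1.
apply: (card_cocycles_vanishing_coprime lifted_actionM lifted_action_irreducible
  nj1 nj tj1 _ ntj).
have [l [k [l_pr El]]] := factor_primary le_jn.
rewrite -(dvdn_pcharf (pchar_Fp p_pr)); apply/negP => pE; apply: ntj.
apply: (pgroup_acts_trivially lifted_actionM lifted_action1 lifted_action_irreducible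
  nj1 nj tj1 (pchar_Fp p_pr)).
rewrite /pgroup El; move: pE; rewrite El Euclid_dvdX // => /andP[].
by rewrite dvdn_prime2 // => /eqP -> _; rewrite pnatX pnat_id.
Qed.

(** A cocycle of gT vanishing on Gam nu is constant on its cosets. *)
Lemma card_Z1_top :
  `#|[set z | z \in Z1 sigma]| = #|Z (Gam nu)|.
Proof.
rewrite -card_fset_set_fin.
apply: (card_set_bij (h := fun (f : {ffun gT -> V}) (b : B nu) => f (repr b))).
  exact: finite_finset.
split=> [f /= fZ|f f' /set_mem /= fZ /set_mem /= fZ' ff'|z /Z1P zM].
- have [fD f0] := cocycles_vanishingP _ _ _ fZ.
  apply/Z1P => b c; have [x _ ->] := cosetP b; have [y _ ->] := cosetP c.
  by rewrite -morphM ?inN //= !(cocycle_constant_coset _ nB fZ) fD.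
- apply/ffunP => x; have := congr1 (@^~ (coset (Gam nu) x)) ff'.
  by rewrite /= (cocycle_constant_coset _ nB fZ) (cocycle_constant_coset _ nB fZ').
exists [ffun x => z (coset (Gam nu) x)]; last first.
  by apply/funext => b; rewrite /= ffunE coset_reprK.
apply/cocycles_vanishingP; split=> [x y|x Nx]; rewrite !ffunE.
  by rewrite morphM ?inN // zM.
(* A cocycle vanishes at the identity. *)
rewrite coset_id //; apply: (addrI (z 1%g)).
by rewrite -{2}[z 1%g]mul1mx -sigma1 -zM mulg1 addr0.
Qed.

Lemma acts_trivially_top : acts_trivially act (Gam nu).
Proof. by move=> x v Nx; rewrite /act coset_id // sigma1 mul1mx. Qed.

Lemma equivariant_endomorphisms_top :
  #|equivariant_endomorphisms act| = #|endomorphisms sigma|.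
Proof.
apply: eq_card => e; apply/equivariant_endomorphismsP/idP.
  move=> [eD eA]; rewrite unfold_in; apply/andP; split.
    by apply/forallP => u; apply/forallP => v; rewrite eD.
  apply/forallP => x; apply/forallP => v; have [y _ ->] := cosetP x.
  by rewrite qproj_coset // eA.
rewrite unfold_in => /andP[/forallP eD /forallP eA]; split=> [u v|x v].
  by apply/eqP; have /forallP := eD u; apply.
by have /forallP/(_ v)/eqP := eA (coset (Gam nu.+1) x); rewrite qproj_coset.
Qed.

(** If [chi] is a coboundary, the difference between the quotient map onto
    B nu.+1 and its composition with a splitting is a cocycle that is injective
    on E nu. *)
Lemma split_top_factor_top : c_chi sigma chi -> split_top_factor nu.
Proof.
case/asboolP => t tP.
have ext : exists f : B nu -> V, forall b c,
    delta1 (sigma \o idfun) f b c = - chi (idfun b) (idfun c).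
  exists (fun b => - t b) => b c; rewrite -(tP b c) /delta1 /= mulmxN.
  by rewrite !opprD !opprK.
have [tau [tauM taupi]] :=
  (obstruction_vanishes top_projM iotaD iota_inj top_kernel secK sigmaE chiE
    (rho := idfun) (fun _ _ => erefl)).1 ext.
have cM : {morph coset (Gam nu) : x y / (x * y)%g} by move=> x y; rewrite morphM ?inN.
have tl : lifts (@qproj gT (Gam nu.+1) (Gam nu)) (coset (Gam nu)) (tau \o coset (Gam nu)).
  by split=> [x y|x] /=; rewrite ?cM ?tauM ?taupi.
have [_ _ /(_ (coset (Gam nu.+1)))] :=
  lifts_torsor top_projM iotaD iota_inj top_kernel secK sigmaE tl.
case=> [|z /= /Z1P zM zE]; first split.
- by move=> x y; rewrite morphM ?inN.
- by move=> x; rewrite qproj_coset.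
apply: split_top_factor_of_cocycle => //; first exact: acts_trivially_top.
exists [ffun x => z x].
  apply/cocycles_vanishingP; split=> [x y|x Nx]; rewrite !ffunE; first exact: zM.
  apply: iota_inj; apply: (mulIg (tau (coset (Gam nu) x))).
  have := congr1 (@^~ x) zE => /= ->; rewrite iota1 mul1g coset_id //.
  rewrite (coset_id (fintype.subsetP sEB _ Nx)).
  by apply: (mulgI (tau 1%g)); rewrite -tauM !mulg1.
have [v v0] := top_neq0.
have := iota_top v => /morphimP[n Nn Gn e]; exists n => //; rewrite ffunE.
apply: contraNneq v0 => zn; apply/eqP/iota_inj; rewrite iota1 e.
have /= <- := congr1 (@^~ n) zE; rewrite zn iota1 mul1g (coset_id Gn).
by apply: (mulgI (tau 1%g)); rewrite -tauM !mulg1.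
Qed.

Lemma alpha_split :
  alpha Gam nu = (\sum_(i < nu) split_top_factor i + split_top_factor nu)%N.
Proof.
rewrite /alpha -sum1_card big_mkcond /= -(big_ord_recr _ (fun i => nat_of_bool (split_top_factor i))).
by apply: eq_bigr => i _; rewrite ssrbool.inE /= /split_top_factor; case: (_ && _).
Qed.

Lemma zeta_acts_trivially : ~~ `[< acts_trivially act (Gam 0) >] = zeta sigma :> nat.
Proof.
congr (nat_of_bool (~~ _)); apply: asbool_equiv_eq; have [G0 _ _] := Gam_chief.
split=> [t b v|t x v _]; last exact: t.
by have [x _ ->] := cosetP b; apply: t; rewrite G0 finset.in_setT.
Qed.

(** If the extension splits, its splittings form a torsor under the cocycles of
    B nu, and the last factor E nu is one of those counted by [alpha], whence the
    exponent. *)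
Lemma card_splittings :
  `#|lifts (@qproj gT (Gam nu.+1) (Gam nu)) (idfun : B nu -> B nu)| =
  (c_chi sigma chi * (#|{: V}| ^ zeta sigma *
     #|endomorphisms sigma| ^ (alpha Gam nu - 1)))%N.
Proof.
rewrite (card_lifts top_projM iotaD iota_inj top_kernel secK sigmaE chiE) //; last first.
  exact: finite_Z1 sigma1 (finite_group_generated _).
have -> : `[< exists f : B nu -> V, forall g h, delta1 (sigma \o idfun) f g h =
    - chi (idfun g) (idfun h) >] = c_chi sigma chi.
  apply: asbool_equiv_eq; split=> -[t tP]; exists (fun b => - t b) => b c.
    by rewrite -[chi b c]opprK -tP /delta1 /= mulmxN !opprD !opprK.
  by rewrite -tP /delta1 /= mulmxN !opprD !opprK.
have [/split_top_factor_top spl|] := boolP (c_chi sigma chi); last by rewrite !mul0n.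
rewrite !mul1n (_ : sigma \o idfun = sigma) // card_Z1_top card_cocycles_chief_series //.
rewrite (asboolT acts_trivially_top) /= zeta_acts_trivially equivariant_endomorphisms_top.
by rewrite alpha_split spl addn1 subn1.
Qed.
End TopFactor.
End ChiefSeries.

(** * Epimorphisms along the tower of quotients *)

Lemma fsbig_fibers (R : pzSemiRingType) (T U : choiceType) (A : set T) (B : set U)
    (h : T -> U) (f : T -> R) :
    finite_set A -> finite_set B -> (forall x, A x -> B (h x)) ->
  \sum_(y \in B) \sum_(x \in A `&` [set x | h x = y]) f x = \sum_(x \in A) f x.
Proof.
move=> finA finB hAB.
under eq_fsbigr => y _ do rewrite fsbig_mkcondr.
rewrite exchange_fsbig //; apply: eq_fsbigr => x /set_mem Ax.
rewrite (fsbigD1 (h x)) //=; last exact: hAB.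
rewrite ifT; last exact: mem_set.
rewrite fsbig1 ?addr0 // => y [_ yx]; case: ifP => // /set_mem /= e.
by case: yx.
Qed.

Section Tower.
Variables (G : groupType) (gT : finGroupType) (nu : nat) (Gam : nat -> {group gT}).
Hypotheses (Gfg : finitely_generated G) (Gam_chief : chief_series nu Gam).

Lemma finite_Epi (E : finGroupType) : finite_set (Epi G E).
Proof. by apply: sub_finite_set (finite_hom E Gfg) => f []. Qed.

(** An epimorphism onto B (m.+1) determines all its projections, so the nested sum
    runs over each epimorphism exactly once. *)
Lemma iterated_sum_Epi m (f : (G -> coset_of (Gam m)) -> rat) : (m <= nu.+1)%N ->
  iterated_sum f = \sum_(rho \in Epi G (coset_of (Gam m))) f rho.
Proof.
elim: m f => [|m IH] f le_mn /=.
  have G1 (x : coset_of (Gam 0)) : x = 1%g.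
    have [y _ ->] := cosetP x; apply: coset_id.
    by have [-> _ _] := Gam_chief; rewrite finset.in_setT.
  have -> : Epi G (coset_of (Gam 0)) = [set fun=> 1%g].
    rewrite eqEsubset; split=> [rho _|_ ->]; first by apply/funext => g.
    split; first by move=> g h; rewrite mulg1.
    by rewrite eqEsubset; split=> // x _; exists 1%g.
  by rewrite fsbig_set1.
rewrite IH; last exact: ltnW.
have nK := chief_series_normal Gam_chief le_mn.
have nH := chief_series_normal Gam_chief (ltnW le_mn).
have sKH : Gam m.+1 \subset Gam m by apply/proper_sub/(chief_series_proper Gam_chief).
pose h (rho : G -> coset_of (Gam m.+1)) : G -> coset_of (Gam m) :=
  fun g => qproj (Gam m) (rho g).
rewrite -(fsbig_fibers (h := h) _ (finite_Epi _) (finite_Epi (coset_of (Gam m)))).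
  apply: eq_fsbigr => rho _; apply: eq_fsbigl.
  rewrite eqEsubset; split=> rho' [rho'E rho'P]; split=> //; first exact/funext.
  by move=> g; rewrite -rho'P.
move=> rho [rhoM rhoT]; split=> [g k|]; first by rewrite /h rhoM (qprojM nK nH sKH).
rewrite eqEsubset; split=> // b _; have [x _ ->] := cosetP b.
have [g _ e] : range rho (coset (Gam m.+1) x) by rewrite rhoT.
by exists g => //; rewrite /h e qproj_coset.
Qed.

Lemma card_Epi_top : `#|Epi G gT| = `#|Epi G (coset_of (Gam nu.+1))|.
Proof.
have [_ G1 _] := Gam_chief.
have nN x : x \in 'N(Gam nu.+1)%g.
  exact/in_normal_setT/(chief_series_normal Gam_chief).
have cM : {morph coset (Gam nu.+1) : x y / (x * y)%g} by move=> x y; rewrite morphM.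
have cinj : injective (coset (Gam nu.+1)).
  move=> x y e; apply/eqP; rewrite eq_mulgV1; apply/eqP/set1gP.
  have <- : Gam nu.+1 :=: 1%g by rewrite G1.
  apply: coset_idr => //.
  by rewrite cM morphV ?nN //= e mulgV.
apply/esym/(card_set_bij (h := fun f : G -> gT => coset (Gam nu.+1) \o f)).
  exact: finite_Epi.
split=> [f [fM fT]|f f' _ _ ff'|f [fM fT]].
- split=> [g k|]; first by rewrite /= fM cM.
  rewrite eqEsubset; split=> // b _; have [x _ ->] := cosetP b.
  by have [g _ <-] : range f x by [rewrite fT]; exists g.
- by apply/funext => g; apply/cinj/(congr1 (@^~ g) ff').
exists (fun g => repr (f g)); last by apply/funext => g /=; rewrite coset_reprK.
split=> [g k|].
  by apply: cinj; rewrite cM !coset_reprK fM.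
rewrite eqEsubset; split=> // x _.
have [g _ e] : range f (coset (Gam nu.+1) x) by rewrite fT.
by exists g => //; apply: cinj; rewrite coset_reprK.
Qed.

End Tower.

Theorem corollary4p8
  (G : groupType) (G_fp : finitely_presented G)
  (gT : finGroupType) (gT_sol : solvable [set: gT]%G)
  (nu : nat) (Gam : nat -> {group gT}) (Gam_chief : chief_series nu Gam)
  (q s : nat -> nat) (q_prime : forall i, (i <= nu)%N -> prime (q i))
  (* E_i = Gam i / Gam i.+1, identified with (Z/q_i)^(s_i) *)
  (iota : forall i, 'cV['F_(q i)]_(s i) -> coset_of (Gam i.+1))
  (iotaD : forall i, (i <= nu)%N ->
     {morph iota i : u v / u + v >-> (u * v)%g})
  (iota_inj : forall i, (i <= nu)%N -> injective (iota i))
  (iota_im : forall i, (i <= nu)%N ->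
     range (iota i) = [set x | x \in (Gam i / Gam i.+1)%g])
  (* a normalized section of B_(nu+1) -> B_nu, its monodromy and 2-cocycle *)
  (sec : coset_of (Gam nu) -> coset_of (Gam nu.+1))
  (sec1 : sec 1%g = 1%g)
  (secK : forall b, qproj (Gam nu) (sec b) = b)
  (sigma : coset_of (Gam nu) -> 'M['F_(q nu)]_(s nu))
  (sigmaE : forall b a,
     iota nu (sigma b *m a) = (sec b * iota nu a * (sec b)^-1)%g)
  (chi : coset_of (Gam nu) -> coset_of (Gam nu) -> 'cV['F_(q nu)]_(s nu))
  (chiE : forall b b',
     iota nu (chi b b') = (sec b * sec b' * (sec (b * b'))^-1)%g)
  (kappa : nat) (kappaE : (q nu ^ kappa)%N = #|endomorphisms sigma|) :
  finite_set (Epi G gT) /\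
  #|` fset_set (Epi G gT)|%:R =
    iterated_sum (fun rho : G -> coset_of (Gam nu) =>
      #|(Gam nu / Gam nu.+1)%g|%:R ^+ zeta sigma *
      ((epsilon sigma chi rho)%:R * (q nu)%:R ^+ dimension (H1 (sigma \o rho))
       - (c_chi sigma chi)%:R
         * (q nu)%:R ^ (kappa%:Z * ((alpha Gam nu)%:Z - 1)))).
Proof.
have Gfg := finitely_presented_generated G_fp.
split; first exact: finite_Epi.
have [[iD inj] im] := (iotaD nu (leqnn nu), iota_inj nu (leqnn nu), iota_im nu (leqnn nu)).
have p_pr := q_prime nu (leqnn nu).
have card_V i : (i <= nu)%N -> #|{: 'cV['F_(q i)]_(s i)}| = (q i ^ s i)%N.
  by move=> le_in; rewrite card_mx card_Fp ?q_prime // muln1.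
have primary i : (i <= nu)%N ->
    exists l k, prime l /\ #|(Gam i / Gam i.+1)%g| = (l ^ k)%N.
  move=> le_in; exists (q i), (s i); split; first exact: q_prime.
  rewrite -card_V // -(card_codom (iota_inj i le_in)); apply: eq_card => x.
  apply/idP/codomP => [xE|[v ->]].
    by have [v _ <-] : range (iota i) x by [rewrite iota_im]; exists v.
  have : range (iota i) (iota i v) by exists v.
  by rewrite iota_im.
have piM := top_projM Gam_chief.
have ker := top_kernel Gam_chief im.
have sigmaM := monodromyM piM iD inj ker secK sigmaE.
have sigma1 := monodromy1 piM iD inj ker secK sigmaE.
have irr := top_irreducible Gam_chief iD inj im secK sigmaE.
rewrite (card_Epi_top Gfg Gam_chief) -fsbig_const1; last exact: finite_Epi.
rewrite -(iterated_sum_Epi Gfg Gam_chief (fun=> 1)) //=.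
rewrite !(iterated_sum_Epi Gfg Gam_chief) //; apply: eq_fsbigr => rho /set_mem [rhoM rhoT].
have rho_onto b : exists g, rho g = b.
  by have [g _ <-] : range rho b by [rewrite rhoT]; exists g.
have finL : finite_set (lifts (@qproj gT (Gam nu.+1) (Gam nu)) rho).
  by apply: sub_finite_set (finite_hom _ Gfg) => f [].
have rho1 : rho 1%g = 1%g by apply: (mulgI (rho 1%g)); rewrite -rhoM !mulg1.
have srM g h : (sigma \o rho) (g * h)%g = (sigma \o rho) g *m (sigma \o rho) h.
  by rewrite /= rhoM sigmaM.
have sr1 : (sigma \o rho) 1%g = 1%:M by rewrite /= rho1.
have sr_irr : irreducible_action (sigma \o rho).
  by move=> W W0 WB Wact; apply: irr => // b v; have [g <-] := rho_onto b; apply: Wact.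
rewrite fsbig_const1; last first.
  by apply: sub_finite_set finL => f [[fM _] fP].
have -> : EpiLift (Gam nu.+1) rho =
    lifts (@qproj gT (Gam nu.+1) (Gam nu)) rho `&` [set f | range f = setT].
  by rewrite eqEsubset; split=> f [[h1 h2] h3].
have := card_surjective_lifts piM iD inj ker secK sigmaE rhoM rho_onto irr
  (top_neq0 Gam_chief iD im) finL.
rewrite (card_splittings Gam_chief p_pr iD inj im secK sigmaE chiE primary).
rewrite (card_lifts piM iD inj ker secK sigmaE chiE rhoM (finite_Z1 sr1 Gfg)).
rewrite (card_Z1 srM sr1 Gfg sr_irr) card_Fp // -kappaE -(card_top inj im) -/(epsilon _ _ _).
have -> : `[< forall g (v : 'cV['F_(q nu)]_(s nu)), (sigma \o rho) g *m v = v >] =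
    `[< forall b (v : 'cV['F_(q nu)]_(s nu)), sigma b *m v = v >].
  apply: asbool_equiv_eq; split=> t g v; last exact: t.
  by have [k <-] := rho_onto g; apply: t.
rewrite -/(zeta sigma).
move/(congr1 (fun n => n%:R : rat)); rewrite natrD !natrM !natrX => e.
rewrite mulrBr !mulrA -[_ * _%:R](mulrC) -!mulrA -e.
have pow : c_chi sigma chi -> (q nu)%:R ^+ kappa ^+ (alpha Gam nu - 1) =
    (q nu)%:R ^ (kappa%:Z * ((alpha Gam nu)%:Z - 1)) :> rat.
  move=> /(split_top_factor_top Gam_chief iD inj im secK sigmaE chiE) spl.
  by rewrite alpha_split spl addn1 subn1 /= intS [1 + _]addrC addrK -exprM exprnP PoszM.
by case: c_chi pow => [->|_]; rewrite ?mul0r ?mulr0 ?subr0 ?addr0 ?mul1r ?addrK.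
Qed.
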